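(* Let $Q>1$, and let $(X,d,\mu)$ and $(Y,d',\nu)$ be metric measure spaces of locally $Q$-bounded geometry, where $X$ and $Y$ are path connected. Assume furthermore that $(Y,d',\nu)$ is $Q$-Loewner. Let $x_0\in X$ be a given point, let $U\subset X$ be an open neighbourhood of $x_0$, and put $U_{x_0}=U\setminus\{x_0\}$. Let $f:U_{x_0}\to Y$ be a quasiconformal mapping (under the convention, stated in the context, that quasiconformal mappings preserve boundaries if these are present) such that for every ball $B(x_0,r)\Subset U$ the set $$C=\partial f\big(\overline{B(x_0,r)}\setminus\{x_0\}\big)\setminus f\big(\partial B(x_0,r)\big)$$ is a continuum in $Y$. Then there exist a point $y_0\in Y$ and an open neighbourhood $U'\subset Y$ of $y_0$ such that $f(U_{x_0})=U'\setminus\{y_0\}$.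
   Context: **Metric measure space.** A triple $(X,d,\mu)$ where $(X,d)$ is a separable metric space and $\mu$ is a locally finite Borel regular measure on $X$. $B(x,r)$ denotes the open ball of centre $x$ and radius $r>0$; the bar denotes topological closure and $\partial$ topological boundary (in $X$ or $Y$ respectively). $B(x_0,r)\Subset U$ means that $\overline{B(x_0,r)}$ is compact and contained in $U$. A continuum is a nonempty compact connected set; it is nondegenerate if it contains more than one point (a single point is a degenerate continuum). **Modulus.** For a family $\Gamma$ of curves in $X$ and $p\ge 1$, the $p$-modulus is $$\mathrm{Mod}_p\,\Gamma=\inf_{\varrho}\int_X \varrho^p\,d\mu,$$ where the infimum is over all Borel functions $\varrho:X\to[0,\infty]$ with $\int_\gamma \varrho\,dl\ge 1$ for every (locally rectifiable) $\gamma\in\Gamma$, $l$ denoting arc length. $\Gamma(E,F,V)$ denotes the family of all curves in an open set $V$ joining two disjoint closed subsets $E$ and $F$ of $V$. **Locally $Q$-bounded geometry.** $(X,d,\mu)$ is of locally $Q$-bounded geometry, $Q>1$, if $(X,d)$ is separable, pathwise connected and locally compact, and there exist constants $C_0\ge 1$, $0<\lambda\le 1$ and a decreasing function $\psi:(0,\infty)\to(0,\infty)$ such that each point of $X$ has a relatively compact neighbourhood $W$ for which: (1) $\mu(B(x,r))\le C_0 r^Q$ for all balls $B(x,r)\subset W$; and (2) $\mathrm{Mod}_Q\,\Gamma(E,F,B(x,r))\ge\psi(t)$ whenever $B(x,r)\subset W$, $t>0$, and $E$ and $F$ are two disjoint nondegenerate continua in $B(x,\lambda r)$ with $\mathrm{dist}(E,F)\le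 t\min\{\mathrm{diam}\,E,\mathrm{diam}\,F\}$. **$Q$-Loewner.** $(Y,d',\nu)$ is $Q$-Loewner if there exists a decreasing function $\phi:(0,\infty)\to(0,\infty)$ such that $\mathrm{Mod}_Q\,\Gamma(E,F,Y)\ge\phi(t)$ whenever $t>0$ and $E$ and $F$ are two disjoint nondegenerate continua in $Y$ with $\mathrm{dist}(E,F)\le t\min\{\mathrm{diam}\,E,\mathrm{diam}\,F\}$. **Quasiconformal mapping.** Let $X,Y$ be of locally $Q$-bounded geometry. A quasiconformal mapping $f:V\to Y$ of an open set $V\subset X$ is a homeomorphism of $V$ onto an open subset $V'=f(V)$ of $Y$ satisfying one of the following two conditions, which are known to be equivalent in this setting: (i) (metric) there is a constant $H\ge 1$ such that for all $x\in V$, $$\limsup_{r\to 0}\frac{\max\{d'(f(x),f(y)): y\in V,\ d(x,y)\le r\}}{\min\{d'(f(x),f(y)): y\in V,\ d(x,y)\ge r\}}\le H;$$ (ii) (geometric) there is a constant $K\ge 1$ such that $\frac1K\mathrm{Mod}_Q\,\Gamma\le \mathrm{Mod}_Q\,f(\Gamma)\le K\,\mathrm{Mod}_Q\,\Gamma$ for every family $\Gamma$ of curves in $V$, where $f(\Gamma)=\{f\circ\gamma:\gamma\in\Gamma\}$. **Standing convention.** A quasiconformal mapping is assumed to preserve boundaries if they are present in its domain; i.e. when the spaces are manifolds with boundary, $f$ maps boundary points of $X$ lying in its domain to boundary points of $Y$. *)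

(* Defs.v *)
From HB Require Import structures.
From mathcomp Require Import all_boot all_order all_algebra.
From mathcomp Require Import all_classical all_reals all_analysis measurable_realfun.

Set Implicit Arguments.
Unset Strict Implicit.
Unset Printing Implicit Defensive.

Import Order.TTheory GRing.Theory Num.Theory.
Import numFieldNormedType.Exports.

Local Open Scope classical_set_scope.
Local Open Scope ring_scope.

(* Metric spaces carrying their Borel sigma-algebra. A locally finite Borel
   regular (outer) measure is entirely determined by its restriction to the
   Borel sets, and every measure on the Borel sets is the restriction of
   exactly one Borel regular outer measure (mu A being the infimum of mu B over
   the Borel sets B containing A). Such a measure is therefore given as an
   element of {measure set X -> \bar R}, where "measurable" means "Borel". *)
HB.mixin Record isBorel (R : numDomainType) (d : measure_display) (T : Type)
    & Metric R T & Measurable d T := {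
  measurable_borel : @measurable d T = <<s @open T >>
}.

#[short(type="borelMetricType")]
HB.structure Definition BorelMetric (R : numDomainType) (d : measure_display) :=
  { T of isBorel R d T & Metric R T & Measurable d T }.

Section topological_notions.
Context {T : topologicalType}.
Implicit Types A : set T.

Definition boundary A : set T := closure A `\` interior A.

Definition continuum A := [/\ A !=set0, compact A & connected A].

Definition nondegenerate_continuum A :=
  continuum A /\ exists x y, [/\ A x, A y & x <> y].

Definition separable_space := exists2 D : set T, countable D & dense D.

End topological_notions.
Arguments separable_space T : clear implicits.

Definition pathwise_connected (R : realType) (T : topologicalType) :=
  forall x y : T, exists g : R -> T,
    [/\ {within `[0, 1]%classic, continuous g}, g 0 = x & g 1 = y].

Definition homeomorphism_on (S T : topologicalType) (A : set S) (B : set T)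
    (f : S -> T) :=
  [/\ set_bij A B f, {within A, continuous f} &
      exists2 g : T -> S, {in A, cancel f g} & {within B, continuous g}].

Section manifolds.
Context {R : realType}.

Definition half_space (n : nat) : set 'rV[R]_n.+1 :=
  [set v | 0 <= v ord0 ord_max].

Definition half_chart (n : nat) (T : topologicalType) (x : T)
    (V : set T) (phi : T -> 'rV[R]_n.+1) :=
  open_nbhs x V /\
  exists2 W : set 'rV[R]_n.+1, open W &
    homeomorphism_on V (W `&` @half_space n) phi.

(* Manifolds with (possibly empty) boundary, of dimension n.+1; the separation
   and countability axioms hold in every separable metric space. There are no
   boundary points in dimension 0. *)
Definition manifold (n : nat) (T : topologicalType) :=
  forall x : T, exists V phi, @half_chart n T x V phi.

Definition manifold_boundary (n : nat) (T : topologicalType) : set T :=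
  [set x | exists V phi, @half_chart n T x V phi /\ phi x ord0 ord_max = 0].

Definition preserves_boundary (S T : topologicalType) (V : set S)
    (f : S -> T) :=
  forall n m, manifold n S -> manifold m T ->
  forall x, V x -> manifold_boundary n x -> manifold_boundary m (f x).

End manifolds.

(* A curve is a continuous map of an interval, possibly open or unbounded; only
   the values of [cmap] on [cdom] are meaningful. *)
Record curve (R : realType) (T : topologicalType) := Curve {
  cdom : set R ;
  cmap :> R -> T ;
  cdom_nonempty : cdom !=set0 ;
  cdom_interval : is_interval cdom ;
  cmap_continuous : {within cdom, continuous cmap}
}.

Definition curves_in (R : realType) (T : topologicalType) (V : set T) :
    set (curve R T) :=
  [set c | c @` cdom c `<=` V].

(* All representatives of the curves f o c, c in Gamma: their values outside the
   interval of definition are arbitrary. *)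
Definition image_curves (R : realType) (S T : topologicalType) (f : S -> T)
    (Gamma : set (curve R S)) : set (curve R T) :=
  [set c' | exists2 c, Gamma c &
     cdom c' = cdom c /\ forall t, cdom c t -> c' t = f (c t)].

(* The compact curves of V with one endpoint in E and the other one in F. *)
Definition joining_curves (R : realType) (T : topologicalType)
    (E F V : set T) : set (curve R T) :=
  [set c | curves_in V c /\ exists a b : R,
     [/\ a <= b, cdom c = `[a, b]%classic &
         (E (c a) /\ F (c b)) \/ (F (c a) /\ E (c b))]].

Section line_integral.
Context {R : realType} {T : metricType R}.
Implicit Types (g : R -> T) (a b : R) (rho : T -> \bar R).
Local Open Scope ereal_scope.

(* Metric analogue of [variation] and [total_variation]. *)
Definition arc_length g a b : \bar R :=
  ereal_sup [set (let F := g \o nth b (a :: s) in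
    \sum_(0 <= n < size s) mdist (F n) (F n.+1))%R%:E
    | s in itv_partition a b].

Definition arc_parametrization g a b (l : R) : T :=
  g (inf [set t | (a <= t <= b)%R /\ arc_length g a t = l%:E]).

Definition locally_rectifiable (c : curve R T) :=
  forall a b, cdom c a -> cdom c b -> (a <= b)%R -> arc_length c a b < +oo.

Definition line_integral_on rho g a b : \bar R :=
  \int[lebesgue_measure]_(l in `[0%R, fine (arc_length g a b)])
    rho (arc_parametrization g a b l).

(* Meaningful for locally rectifiable curves: the supremum of the integrals
   over the compact subcurves. *)
Definition line_integral rho (c : curve R T) : \bar R :=
  ereal_sup [set line_integral_on rho c ab.1 ab.2 | ab in
    [set ab : R * R | [/\ cdom c ab.1, cdom c ab.2 & (ab.1 <= ab.2)%R]]].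

Definition set_diam (A : set T) : \bar R :=
  ereal_sup [set (mdist z.1 z.2)%:E | z in A `*` A].

Definition set_dist (A B : set T) : \bar R :=
  ereal_inf [set (mdist z.1 z.2)%:E | z in A `*` B].

End line_integral.

Section modulus.
Context {R : realType} {d : measure_display} {X : borelMetricType R d}.
Implicit Types (mu : {measure set X -> \bar R}) (Gamma : set (curve R X)).
Local Open Scope ereal_scope.

Definition admissible Gamma (rho : X -> \bar R) :=
  [/\ measurable_fun [set: X] rho, forall x, 0 <= rho x &
      forall c, Gamma c -> locally_rectifiable c -> 1 <= line_integral rho c].

Definition modulus (p : R) mu Gamma : \bar R :=
  ereal_inf [set \int[mu]_x (rho x `^ p) | rho in admissible Gamma].

Definition locally_finite_measure mu :=
  forall x : X, exists2 W, open_nbhs x W & mu W < +oo.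

Definition metric_measure_space mu :=
  separable_space X /\ locally_finite_measure mu.

(* Modulus bound from below for the curves joining in V two continua of A; in
   existential position it does not matter whether "decreasing" is strict. *)
Definition loewner_bound (Q : R) mu (psi : R -> R) (A V : set X) :=
  forall (t : R) (E F : set X), (0 < t)%R ->
    nondegenerate_continuum E -> nondegenerate_continuum F ->
    E `&` F = set0 -> E `<=` A -> F `<=` A ->
    set_dist E F <= t%:E * mine (set_diam E) (set_diam F) ->
    (psi t)%:E <= modulus Q mu (joining_curves E F V).

Definition decreasing_positive (psi : R -> R) :=
  (forall t, (0 < t)%R -> (0 < psi t)%R) /\
  (forall s t, (0 < s)%R -> (s <= t)%R -> (psi t <= psi s)%R).

Definition locally_bounded_geometry (Q : R) mu :=
  [/\ separable_space X, pathwise_connected R X, locally_compact [set: X] &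
   exists (C0 lambda : R) (psi : R -> R),
    [/\ (1 <= C0)%R, (0 < lambda <= 1)%R, decreasing_positive psi &
     forall z : X, exists W : set X,
      [/\ nbhs z W, precompact W,
       forall (x : X) (r : R), (0 < r)%R -> ball x r `<=` W ->
         mu (ball x r) <= (C0 * r `^ Q)%:E &
       forall (x : X) (r : R), (0 < r)%R -> ball x r `<=` W ->
         loewner_bound Q mu psi (ball x (lambda * r)) (ball x r)]]].

Definition loewner (Q : R) mu :=
  exists2 phi : R -> R, decreasing_positive phi &
    loewner_bound Q mu phi [set: X] [set: X].

End modulus.

Section quasiconformal.
Context {R : realType} {d d' : measure_display}.
Context {X : borelMetricType R d} {Y : borelMetricType R d'}.
Implicit Types (V : set X) (f : X -> Y).
Local Open Scope ereal_scope.

(* The extrema are taken in \bar R as suprema and infima, with value +oo for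
   the infimum of the empty set. *)
Definition metric_quasiconformal V f :=
  exists2 H : R, (1 <= H)%R & forall x, V x ->
    limf_esup (fun r : R =>
      ereal_sup [set (mdist (f x) (f y))%:E
                | y in [set y | V y /\ (mdist x y <= r)%R]] /
      ereal_inf [set (mdist (f x) (f y))%:E
                | y in [set y | V y /\ (r <= mdist x y)%R]]) 0%R^'+ <= H%:E.

Definition geometric_quasiconformal (Q : R) (mu : {measure set X -> \bar R})
    (nu : {measure set Y -> \bar R}) V f :=
  exists2 K : R, (1 <= K)%R & forall Gamma, Gamma `<=` curves_in V ->
    (K^-1)%:E * modulus Q mu Gamma <= modulus Q nu (image_curves f Gamma) /\
    modulus Q nu (image_curves f Gamma) <= K%:E * modulus Q mu Gamma.

(* f is only relevant on V. *)
Definition quasiconformal (Q : R) (mu : {measure set X -> \bar R})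
    (nu : {measure set Y -> \bar R}) V f :=
  [/\ open V, open (f @` V), homeomorphism_on V (f @` V) f,
      metric_quasiconformal V f \/ geometric_quasiconformal Q mu nu V f &
      @preserves_boundary R X Y V f].

End quasiconformal.

(* Main.v *)
Require Import Defs.
From mathcomp Require Import all_boot all_order all_algebra finmap.
From mathcomp Require Import all_classical all_reals all_analysis.
From mathcomp Require Import measurable_realfun lra ring.

(* Let [B] be a small ball around [x0], [G] the image of the punctured ball and
   [C] the given set; a path from [G] to its complement, near a point of [C], first
   leaves [G] at the limit of the image of a path tending to [x0]. Such paths exist
   near each point of [C]: small continua are joined by curves, because the
   families of curves of the Loewner condition have positive modulus. If [C] had two
   points [y1] and [y2], there would be two paths tending to [x0] with images near
   [y1] and near [y2]. At each small scale [t] they contain continua of diameter and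
   distance comparable to [t], so the curves joining these have modulus bounded
   below, even after discarding those through [x0], whose modulus vanishes since
   [Q > 1]. The images of the remaining curves travel a fixed distance within
   [f(B(x0, t) \ x0)], whose measure near [y1] tends to [0]. For a geometrically
   quasiconformal map this bounds the modulus directly; for a metrically
   quasiconformal one, a Vitali covering by small balls whose images are roundish
   turns it into an admissible density on [X] of small [Q]-norm. Hence
   [C = {y0}]. Finally a small ball around [y0] minus [y0] lies in [G]: curves from
   [G] avoiding [y0] cannot leave [G] there, and they reach every other point, the
   curves through [y0] having modulus zero. *)

Set Implicit Arguments.
Unset Strict Implicit.
Unset Printing Implicit Defensive.

Import Order.TTheory GRing.Theory Num.Theory.
Import numFieldNormedType.Exports.

Local Open Scope classical_set_scope.
Local Open Scope ring_scope.


(** Sequences tending to [x0] would not do: the Loewner condition compares the diameters of two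
    continua with their distance, so one needs connected sets near [x0] at every scale whose images
    stay near a given point. This is why every limit at the puncture is reached along a path.
    Bounded geometry bounds masses only from above. The lower bound that turns the size of a round
    image into measure is itself drawn from the Loewner condition on [Y]. The metric definition
    controls [f] at a point only below a radius depending on that point. One good scale is thus
    chosen at each point, and the points where [f] varies too little to yield a ball in the image
    are charged to a term with a factor [eps], chosen last. Line integrals involve a density
    composed with an arc length parametrization, whose measurability is never established. They are
    only bounded from below, by crossings of disjoint spherical shells on which the density is at
    least a constant. *)

Section metric_balls.
Context {R : realType} {T : metricType R}.

Lemma ballP (p x : T) (r : R) : ball p r x <-> mdist p x < r.
Proof. by rewrite ballEmdist. Qed.

Lemma open_ball_metric (p : T) (r : R) : open (ball p r).
Proof.
rewrite openE => x /ballP px; apply/nbhs_ballP.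
exists (r - mdist p x) => /=; first by rewrite subr_gt0.
move=> y /ballP xy; apply/ballP.
by apply: le_lt_trans (metric_triangle p x y) _; rewrite -ltrBrDl.
Qed.

End metric_balls.

(** * Curves and arc length *)

Section within_eps_delta.
Context {R : realType}.

Lemma within_continuous_mdistP (T : metricType R) (A : set R) (g : R -> T) :
  {within A, continuous g} <->
  forall t, A t -> forall e : R, 0 < e -> exists2 del : R, 0 < del &
    forall t', A t' -> `|t - t'| < del -> mdist (g t) (g t') < e.
Proof.
split=> [/subspace_continuousP gc t At e e0|H].
  have /metricType_numDomainType.cvgrPdist_lt/(_ e e0) := gc t At.
  rewrite near_withinE => /nbhs_ballP[del /= del0 H].
  by exists del => // t' At' tt'; apply: H.
apply/subspace_continuousP => t At.
apply/metricType_numDomainType.cvgrPdist_lt => e e0.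
have [del del0 {}H] := H t At e e0.
rewrite near_withinE; apply/nbhs_ballP; exists del => //= t' tt' At'.
exact: H.
Qed.

Lemma within_continuous_normP (A : set R) (g : R -> R) :
  {within A, continuous g} <->
  forall t, A t -> forall e : R, 0 < e -> exists2 del : R, 0 < del &
    forall t', A t' -> `|t - t'| < del -> `|g t - g t'| < e.
Proof.
split=> [/subspace_continuousP gc t At e e0|H].
  have /cvgrPdist_lt/(_ e e0) := gc t At.
  rewrite near_withinE => /nbhs_ballP[del /= del0 H].
  by exists del => // t' At' tt'; apply: H.
apply/subspace_continuousP => t At.
apply/cvgrPdist_lt => e e0.
have [del del0 {}H] := H t At e e0.
rewrite near_withinE; apply/nbhs_ballP; exists del => //= t' tt' At'.
exact: H.
Qed.

Lemma mdist_triangle_abs (T : metricType R) (x y z : T) :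
  `|mdist x z - mdist y z| <= mdist x y.
Proof.
have h1 := metric_triangle x y z; have h2 := metric_triangle y x z.
rewrite (metric_sym y x) in h2.
by rewrite ler_norml; apply/andP; split; lra.
Qed.

Lemma within_continuous_mdist (T : metricType R) (A : set R) (g : R -> T) z :
  {within A, continuous g} -> {within A, continuous (fun t => mdist (g t) z)}.
Proof.
move=> /within_continuous_mdistP gc; apply/within_continuous_normP => t At e e0.
have [del del0 H] := gc t At e e0; exists del => // t' At' tt'.
exact: le_lt_trans (mdist_triangle_abs _ _ _) (H _ At' tt').
Qed.

End within_eps_delta.

Section arc_length.
Context {R : realType} {T : metricType R}.
Implicit Types (g : R -> T) (a b c t u v : R) (s : seq R).

(** The sum in [arc_length] in recursive form, so that partitions can be concatenated and treated by
    induction. *)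
Fixpoint polygon_length g a s : R :=
  if s is x :: s' then mdist (g a) (g x) + polygon_length g x s' else 0.

Lemma polygon_length_cat g a s1 s2 :
  polygon_length g a (s1 ++ s2) =
  polygon_length g a s1 + polygon_length g (last a s1) s2.
Proof. by elim: s1 a => [|x s1 ih] a /=; rewrite ?add0r// ih addrA. Qed.

Lemma sum_polygon_length g a b s :
  \sum_(0 <= n < size s) mdist (g (nth b (a :: s) n)) (g (nth b (a :: s) n.+1))
  = polygon_length g a s.
Proof.
elim: s a => [|x s ih] a; first by rewrite big_nil.
by rewrite /= big_nat_recl//= ih.
Qed.

Lemma arc_lengthE g a b : arc_length g a b =
  ereal_sup [set (polygon_length g a s)%:E | s in itv_partition a b].
Proof.
by congr ereal_sup; apply: eq_imagel => s _ /=; rewrite sum_polygon_length.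
Qed.

Lemma arc_length_polygon g a b s : itv_partition a b s ->
  ((polygon_length g a s)%:E <= arc_length g a b)%E.
Proof. by move=> abs; rewrite arc_lengthE; apply: ereal_sup_ubound; exists s. Qed.

Lemma arc_length_mdist g a b : a <= b ->
  ((mdist (g a) (g b))%:E <= arc_length g a b)%E.
Proof.
rewrite le_eqVlt => /predU1P[->|ab].
  rewrite mdistxx; apply: (@arc_length_polygon g b b [::]).
  by split => //=.
by have := @arc_length_polygon g a b [:: b] (itv_partition1 ab); rewrite /= addr0.
Qed.

Lemma arc_length_ge0 g a b : a <= b -> (0 <= arc_length g a b)%E.
Proof.
by move=> ab; apply: le_trans (arc_length_mdist g ab); rewrite lee_fin mdist_ge0.
Qed.

Lemma arc_lengthxx g a : arc_length g a a = 0%E.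
Proof.
apply/eqP; rewrite eq_le arc_length_ge0// andbT arc_lengthE.
by apply: ge_ereal_sup => _ [s /itv_partitionxx -> <-].
Qed.

Lemma arc_length_superadd g a b c : a <= b -> b <= c ->
  (arc_length g a b + arc_length g b c <= arc_length g a c)%E.
Proof.
move=> ab bc.
have key s : itv_partition a b s ->
    ((polygon_length g a s)%:E + arc_length g b c <= arc_length g a c)%E.
  move=> abs; rewrite -leeBrDl// {1}arc_lengthE; apply: ge_ereal_sup => _ [s' bcs' <-].
  rewrite leeBrDl// -EFinD.
  have := arc_length_polygon g (itv_partition_cat abs bcs').
  by rewrite polygon_length_cat; case: abs => _ /eqP ->.
have [abfin|] := boolP (arc_length g b c \is a fin_num).
  rewrite -leeBrDr// {1}arc_lengthE; apply: ge_ereal_sup => _ [s abs <-].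
  by rewrite leeBrDr//; exact: key.
(* When the second length is infinite it cannot be subtracted; adding the single chord from [a] to
   [b] already forces the total length to be infinite. *)
rewrite ge0_fin_numE ?arc_length_ge0// -leNgt leye_eq => /eqP bcy.
have : ((mdist (g a) (g b))%:E + arc_length g b c <= arc_length g a c)%E.
  move: ab; rewrite le_eqVlt => /predU1P[ab|ab].
    have := key [::]; rewrite ab mdistxx/=; apply; split => //=; exact/eqP.
  by have := key [:: b] (itv_partition1 ab); rewrite /= addr0.
by rewrite bcy addey// leye_eq => /eqP ->; rewrite leey.
Qed.

Lemma arc_length_subadd g a b c : a <= b -> b <= c ->
  (arc_length g a c <= arc_length g a b + arc_length g b c)%E.
Proof.
move=> ab bc; rewrite {1}arc_lengthE; apply: ge_ereal_sup => _ [s + <-].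
elim: s a ab => [|x s ih] a ab.
  by move=> _ /=; rewrite adde_ge0// arc_length_ge0.
move=> /[dup] acs [/= /andP[ax xs] /eqP lxs].
(* If [b] lies inside the first edge, it is inserted there by the triangle inequality; otherwise
   induction applies to the rest of the partition. *)
have [xb|bx] := leP x b.
  have xcs : itv_partition x c s by split => //=; apply/eqP.
  rewrite EFinD; apply: (@le_trans _ _ ((mdist (g a) (g x))%:E +
      (arc_length g x b + arc_length g b c))%E).
    by rewrite leeD2l// ih.
  rewrite addeA leeD2r//.
  apply: le_trans (arc_length_superadd g (ltW ax) xb).
  by rewrite leeD2r// arc_length_mdist// ltW.
rewrite EFinD; apply: (@le_trans _ _ ((mdist (g a) (g b))%:E +
   ((mdist (g b) (g x))%:E + (polygon_length g x s)%:E))%E).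
  by rewrite addeA leeD2r// -EFinD lee_fin metric_triangle.
apply: leeD; first exact: arc_length_mdist.
rewrite -EFinD; apply: (@arc_length_polygon g b c (x :: s)).
by split => /=; [rewrite bx|apply/eqP].
Qed.

Lemma arc_lengthD g a b c : a <= b -> b <= c ->
  arc_length g a c = (arc_length g a b + arc_length g b c)%E.
Proof.
move=> ab bc; apply/eqP.
by rewrite eq_le arc_length_subadd// arc_length_superadd.
Qed.

(** The point [p] is the first vertex of a nearly optimal polygon. Near [a] the length is thus
    almost that of a chord, which continuity makes small. *)
Lemma arc_length_approx_right g a b e : a < b -> 0 < e ->
  (arc_length g a b < +oo)%E -> exists p, a < p <= b /\
  (arc_length g a b - e%:E <= (mdist (g a) (g p))%:E + arc_length g p b)%E.
Proof.
move=> ab e0 fab.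
have fin : arc_length g a b \is a fin_num.
  by rewrite ge0_fin_numE// arc_length_ge0// ltW.
move: (fin); rewrite arc_lengthE => /(ub_ereal_sup_adherent e0).
rewrite -arc_lengthE => -[_ [[|x s] [/= axs /eqP lxs] <-] lt].
  by move: ab; rewrite -lxs ltxx.
move: axs => /andP[ax xs].
have xbs : itv_partition x b s by split=> //; exact/eqP.
exists x; rewrite ax (itv_partition_le xbs); split => //.
rewrite (le_trans (ltW lt))// EFinD leeD2l//.
exact: arc_length_polygon.
Qed.

Lemma arc_length_approx_left g a b e : a < b -> 0 < e ->
  (arc_length g a b < +oo)%E -> exists p, a <= p < b /\
  (arc_length g a b - e%:E <= arc_length g a p + (mdist (g p) (g b))%:E)%E.
Proof.
move=> ab e0 fab.
have fin : arc_length g a b \is a fin_num.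
  by rewrite ge0_fin_numE// arc_length_ge0// ltW.
move: (fin); rewrite arc_lengthE => /(ub_ereal_sup_adherent e0).
rewrite -arc_lengthE => -[_ [s [/= axs /eqP lxs] <-] lt].
case/lastP: s axs lxs lt => [|s x]; first by move=> /= _ ab'; rewrite ab' ltxx in ab.
rewrite last_rcons rcons_path => /andP[sp lx] xb lt; subst x.
have aps : itv_partition a (last a s) s by split.
exists (last a s); rewrite lx (itv_partition_le aps); split => //.
rewrite (le_trans (ltW lt))// -cats1 polygon_length_cat/= addr0 EFinD leeD2r//.
exact: arc_length_polygon.
Qed.

End arc_length.

Section arc_length_function_def.
Context {R : realType} {T : metricType R}.

Definition arc_time (g : R -> T) (a b l : R) : R :=
  inf [set t | (a <= t <= b) /\ arc_length g a t = l%:E].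

Lemma arc_parametrizationE g a b l :
  arc_parametrization g a b l = g (arc_time g a b l).
Proof. by []. Qed.

End arc_length_function_def.

Section arc_length_function.
Context {R : realType} {T : metricType R}.
Variables (g : R -> T) (a b : R).
Hypothesis gc : {within `[a, b], continuous g}.
Hypothesis fab : (arc_length g a b < +oo)%E.

Local Notation len u v := (fine (arc_length g u v)).

Lemma arc_length_fin u v : a <= u -> u <= v -> v <= b ->
  arc_length g u v = (len u v)%:E.
Proof.
move=> au uv vb; rewrite fineK// ge0_fin_numE ?arc_length_ge0//.
apply: le_lt_trans fab.
rewrite (arc_lengthD g au (le_trans uv vb)) (arc_lengthD g uv vb).
rewrite -[leLHS]add0e leeD ?arc_length_ge0// -[leLHS]adde0 leeD//.
exact: arc_length_ge0.
Qed.

Lemma len_ge0 u v : u <= v -> 0 <= len u v.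
Proof. by move=> uv; rewrite fine_ge0// arc_length_ge0. Qed.

Lemma lenD u v w : a <= u -> u <= v -> v <= w -> w <= b ->
  len u w = len u v + len v w.
Proof.
move=> au uv vw wb; rewrite (arc_lengthD g uv vw) fineD//.
  by rewrite arc_length_fin// (le_trans vw).
by rewrite arc_length_fin// (le_trans au).
Qed.

Lemma le_mdist_len u v : a <= u -> u <= v -> v <= b ->
  mdist (g u) (g v) <= len u v.
Proof.
by move=> au uv vb; rewrite -lee_fin -arc_length_fin// arc_length_mdist.
Qed.

(** With [p] from [arc_length_approx_right], the length from [t] to [t'] exceeds the chord from [t]
    to [t'] by at most [e / 2]: replace the chord from [t] to [p] by a detour through [t']. *)
Lemma len_right_continuous t e : a <= t -> t < b -> 0 < e ->
  exists2 del : R, 0 < del &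
  forall t', t <= t' -> t' <= b -> t' - t < del -> len t t' <= e.
Proof.
move=> at_ tb e0; have e2 : 0 < e / 2 by rewrite divr_gt0.
have ftb : (arc_length g t b < +oo)%E by rewrite arc_length_fin ?ltry// ltW.
have [p [/andP[tp pb] hp]] := arc_length_approx_right tb e2 ftb.
have tI : `[a, b]%classic t by rewrite /= in_itv/= at_ ltW.
have [del del0 H] := (within_continuous_mdistP _ _).1 gc t tI _ e2.
exists (Num.min del (p - t)) => [|t' tt' t'b].
  by rewrite lt_min del0 subr_gt0.
rewrite lt_min => /andP[d1 d2].
have t'p : t' <= p by lra.
have at' : a <= t' by lra.
have d3 : mdist (g t) (g t') < e / 2.
  by apply: H; [rewrite /= in_itv/= at'|rewrite distrC ger0_norm; lra].
have d4 := metric_triangle (g t) (g t') (g p).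
have d5 : mdist (g t') (g p) <= len t' p by apply: le_mdist_len => //; lra.
have d6 : len t b = len t t' + len t' b by apply: lenD => //; lra.
have d7 : len t' b = len t' p + len p b by apply: lenD => //; lra.
move: hp; rewrite (@arc_length_fin t b) 1?(@arc_length_fin p b)//; try lra.
by rewrite -!EFinD lee_fin => hp; lra.
Qed.

Lemma len_left_continuous t e : a < t -> t <= b -> 0 < e ->
  exists2 del : R, 0 < del &
  forall t', a <= t' -> t' <= t -> t - t' < del -> len t' t <= e.
Proof.
move=> at_ tb e0; have e2 : 0 < e / 2 by rewrite divr_gt0.
have ftb : (arc_length g a t < +oo)%E by rewrite arc_length_fin ?ltry// ltW.
have [p [/andP[ap pt] hp]] := arc_length_approx_left at_ e2 ftb.
have tI : `[a, b]%classic t by rewrite /= in_itv/= tb ltW.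
have [del del0 H] := (within_continuous_mdistP _ _).1 gc t tI _ e2.
exists (Num.min del (t - p)) => [|t' at' t't].
  by rewrite lt_min del0 subr_gt0.
rewrite lt_min => /andP[d1 d2].
have pt' : p <= t' by lra.
have t'b : t' <= b by lra.
have d3 : mdist (g t) (g t') < e / 2.
  by apply: H; [rewrite /= in_itv/= at'|rewrite ger0_norm; lra].
have d4 := metric_triangle (g p) (g t') (g t).
rewrite metric_sym in d3.
have d5 : mdist (g p) (g t') <= len p t' by apply: le_mdist_len => //; lra.
have d6 : len a t = len a t' + len t' t by apply: lenD => //; lra.
have d7 : len a t' = len a p + len p t' by apply: lenD => //; lra.
move: hp; rewrite (@arc_length_fin a t) 1?(@arc_length_fin a p)//; try lra.
by rewrite -!EFinD lee_fin => hp; lra.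
Qed.

Lemma len_continuous : {within `[a, b], continuous (fun t => len a t)}.
Proof.
apply/within_continuous_normP => t /=; rewrite in_itv/= => /andP[at_ tb] e e0.
have e2 : 0 < e / 2 by rewrite divr_gt0.
have [dr dr0 Hr] : exists2 del : R, 0 < del &
    forall t', t <= t' -> t' <= b -> t' - t < del -> len t t' <= e / 2.
  move: (tb); rewrite le_eqVlt => /predU1P[tb'|tb'].
    exists 1 => // t' tt' t'b _; have -> : t' = t by lra.
    by rewrite arc_lengthxx/= ltW.
  exact: len_right_continuous.
have [dl dl0 Hl] : exists2 del : R, 0 < del &
    forall t', a <= t' -> t' <= t -> t - t' < del -> len t' t <= e / 2.
  move: (at_); rewrite le_eqVlt => /predU1P[tb'|tb'].
    exists 1 => // t' tt' t'b _; have -> : t' = t by lra.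
    by rewrite arc_lengthxx/= ltW.
  exact: len_left_continuous.
exists (Num.min dl dr); first by rewrite lt_min dl0.
move=> t'; rewrite in_itv/= => /andP[at' t'b]; rewrite lt_min => /andP[h1 h2].
have [tt'|/ltW t't] := leP t t'.
  have h := lenD (lexx a) at_ tt' t'b.
  have h3 := len_ge0 tt'.
  have h4 : len t t' <= e / 2.
    by apply: Hr => //; apply: le_lt_trans h2; rewrite distrC ler_norm.
  by rewrite h ltr_norml; apply/andP; split; lra.
have h := lenD (lexx a) at' t't tb.
have h3 := len_ge0 t't.
have h4 : len t' t <= e / 2.
  by apply: Hl => //; apply: le_lt_trans h1; rewrite ler_norm.
by rewrite h ltr_norml; apply/andP; split; lra.
Qed.

Lemma len_surjective l : a <= b -> 0 <= l -> l <= len a b ->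
  exists t, [/\ a <= t, t <= b & len a t = l].
Proof.
move=> ab l0 lL; have := @IVT R (fun t => len a t) a b l ab len_continuous.
rewrite arc_lengthxx/= => -[|t].
  by rewrite min_l ?max_r ?l0 ?lL// (le_trans l0).
by rewrite in_itv/= => /andP[at_ tb] tl; exists t.
Qed.

(** As [arc_time] is an infimum, strictness on the left needs a margin: by right continuity at [u],
    no length beyond that reached at [u] by a fixed amount is attained immediately after [u]. *)
Lemma arc_parametrizationP u v l : a <= u -> u <= v -> v <= b ->
  len a u < l -> l < len a v ->
  u < arc_time g a b l < v.
Proof.
move=> au uv vb ul lv.
have ab : a <= b by lra.
set S := [set t | (a <= t <= b) /\ arc_length g a t = l%:E].
have [t0 [at0 t0b t0l]] : exists t, [/\ a <= t, t <= b & len a t = l].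
  apply: len_surjective => //; first by rewrite (le_trans _ (ltW ul))// len_ge0.
  rewrite (le_trans (ltW lv))// (lenD (lexx a) (le_trans au uv) vb _)//.
  by rewrite lerDl len_ge0.
have St0 : S t0 by split; [rewrite at0|rewrite arc_length_fin// t0l].
have [del del0 Hdel] : exists2 del : R, 0 < del &
    forall t', u <= t' -> t' <= b -> t' - u < del -> len u t' <= (l - len a u)/2.
  apply: len_right_continuous => //; last by lra.
  rewrite lt_neqAle (le_trans uv vb) andbT; apply/eqP => ub.
  have vu : v = u by lra.
  by move: lv; rewrite vu; lra.
have Sub t : S t -> u + del <= t /\ t < v.
  move=> [/andP[at_ tb] tl]; have {}tl : len a t = l by rewrite tl.
  split; last first.
    rewrite ltNge; apply/negP => vt.
    have := lenD (lexx a) (le_trans au uv) vt tb; have := len_ge0 vt; lra.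
  rewrite leNgt; apply/negP => tu.
  have [ut|/ltW tu'] := leP u t.
    have := Hdel t ut tb; have := lenD (lexx a) au ut tb; lra.
  have := lenD (lexx a) at_ tu' (le_trans uv vb); have := len_ge0 tu'; lra.
rewrite /arc_time -/S; apply/andP; split.
- apply: (@lt_le_trans _ _ (u + del)); first by rewrite ltrDl.
  by apply: lb_le_inf; [exists t0|move=> t /Sub[]].
- apply: le_lt_trans (Sub _ St0).2; apply: ge_inf => //.
  by exists a => t [/andP[]].
Qed.

End arc_length_function.

Section ge0_le_integral_nonmeasurable.
Context d (T : measurableType d) (R : realType) (mu : {measure set T -> \bar R}).
Local Open Scope ereal_scope.

(** The integral of a nonnegative function is a supremum over the simple functions below it, hence
    monotone without measurability. Line integrals are compared in this way. *)
Lemma ge0_le_integral_nonmeasurable (D : set T) (f1 f2 : T -> \bar R) :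
  (forall x, D x -> 0 <= f1 x) -> (forall x, D x -> f1 x <= f2 x) ->
  \int[mu]_(x in D) f1 x <= \int[mu]_(x in D) f2 x.
Proof.
move=> f10 f12; rewrite !(integral_mkcond D).
have h10 x : 0 <= (f1 \_ D) x by apply: erestrict_ge0.
have h12 x : (f1 \_ D) x <= (f2 \_ D) x.
  by rewrite /patch; case: ifPn => // /set_mem /f12.
rewrite !ge0_integralTE//; last by move=> x; apply: le_trans (h12 x).
apply: ge_ereal_sup => _ [h hf <-]; apply: ereal_sup_ubound; exists h => //.
by move=> x; apply: le_trans (hf x) (h12 x).
Qed.

End ge0_le_integral_nonmeasurable.

Section line_integral_lower_bound.
Context {R : realType} {T : metricType R}.

(* Since the arc length is continuous in the time, [arc_parametrization] maps
   the lengths strictly between reached at the times [u i] and [v i] to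
   points reached strictly between the times [u i] and [v i]. *)
Lemma line_integral_on_ge (rho : T -> \bar R) (g : R -> T) (a b : R)
    (I : eqType) (s : seq I) (c u v : I -> R) :
  (forall x, 0 <= rho x)%E ->
  a <= b -> {within `[a, b], continuous g} -> (arc_length g a b < +oo)%E ->
  uniq s ->
  (forall i, i \in s -> [/\ 0 <= c i, a <= u i, u i <= v i & v i <= b]) ->
  (forall i t, i \in s -> u i < t -> t < v i -> ((c i)%:E <= rho (g t))%E) ->
  (forall i j t, i \in s -> j \in s -> u i < t -> t < v i -> u j < t ->
    t < v j -> i = j) ->
  ((\sum_(i <- s) c i * mdist (g (u i)) (g (v i)))%:E <=
    line_integral_on rho g a b)%E.
Proof.
move=> rho0 ab gc fab us suv crho triv.
pose len u v := fine (arc_length g u v).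
pose J i : set R := `]len a (u i), len a (v i)[%classic.
have lenuv i : i \in s -> len a (v i) = len a (u i) + len (u i) (v i).
  by move=> /suv[ci au uv vb]; rewrite [LHS](lenD fab (lexx a) au uv vb).
have param i l : i \in s -> J i l -> u i < arc_time g a b l < v i.
  move=> /suv[ci au uv vb]; rewrite /J/= in_itv/= => /andP[ul lv].
  exact: arc_parametrizationP.
have JL i : i \in s -> J i `<=` `[0, len a b]%classic.
  move=> si l; rewrite /J/= !in_itv/= => /andP[ul lv].
  have [ci au uv vb] := suv _ si.
  rewrite (le_trans _ (ltW ul))/= ?len_ge0//.
  rewrite (le_trans (ltW lv))// {2}/len.
  rewrite (lenD fab (lexx a) (le_trans au uv) vb _)// lerDl.
  exact: len_ge0.
(* The truncation by [Num.max 0] makes the coefficients nonnegative also for indices outside [s], as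
   the integral of a sum requires. *)
have H1 : ((\sum_(i <- s) c i * mdist (g (u i)) (g (v i)))%:E <=
    \int[lebesgue_measure]_(l in `[0%R, len a b]%classic)
    \sum_(i <- s) ((Num.max 0 (c i))%:E * (\1_(J i) l)%:E))%E.
  rewrite ge0_integral_sum//=; last 2 first.
  - move=> i; apply: emeasurable_funM => //; apply/measurable_EFinP.
    by apply: measurable_indic; exact: measurable_itv.
  - move=> i l _; rewrite -EFinM lee_fin mulr_ge0//.
    by rewrite le_max lexx.
  rewrite -sumEFin [leLHS]big_seq [leRHS]big_seq; apply: lee_sum => i si.
  have [ci au uv vb] := suv _ si.
  rewrite max_r// ge0_integralZl_EFin//; last first.
  - apply/measurable_EFinP; by apply: measurable_indic; exact: measurable_itv.
  rewrite integral_indic; [|exact: measurable_itv|exact: measurable_itv].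
  rewrite setIidl; last exact: JL.
  have := lebesgue_measure_itv `]len a (u i), len a (v i)[.
  rewrite /= lte_fin => mJ; rewrite [X in (_ <= _ * X)%E]mJ lenuv//.
  have h := le_mdist_len fab au uv vb.
  case: ltP => h2.
    rewrite -EFinD -EFinM lee_fin ler_wpM2l//.
    by rewrite (_ : _ - _ = len (u i) (v i)) //; ring.
  rewrite mule0 lee_fin mulr_ge0_le0//.
  by apply: le_trans h _; rewrite -/(len _ _); lra.
apply: le_trans H1 _.
apply: ge0_le_integral_nonmeasurable => l Ll.
  rewrite sume_ge0// => i _.
  by rewrite -EFinM lee_fin mulr_ge0// le_max lexx.
have [/hasP[i si /= /asboolP Ji]|] := boolP (has (fun i => `[< J i l >]) s); last first.
  move=> /hasPn h; rewrite big_seq big1 ?rho0// => i /h/asboolP Ji.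
  by rewrite indicE memNset// mule0.
have /andP[ut tv] := param _ _ si Ji; rewrite arc_parametrizationE.
rewrite (bigD1_seq i)//= indicE mem_set// mule1 big_seq_cond big1 ?adde0.
  by rewrite max_r; [exact: crho|have [] := suv _ si].
move=> j /andP[sj ji]; rewrite indicE.
have [/set_mem Jj|_] := boolP (l \in J j); last by rewrite mule0.
have /andP[ut' tv'] := param _ _ sj Jj.
by move: ji; rewrite (triv i j _ si sj ut tv ut' tv') eqxx.
Qed.

End line_integral_lower_bound.

(** * Exits of paths from open sets and crossings of levels *)

Section crossing.
Context {R : realType}.

(** The infimum of the exit times works: if the path were still in the open set [G] at that time, it
    would remain there a little longer. *)
Lemma first_exit (T : topologicalType) (a b : R) (g : R -> T) (G : set T) :
  a <= b -> {within `[a, b], continuous g} -> open G -> G (g a) -> ~ G (g b) ->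
  exists t, [/\ a < t, t <= b, ~ G (g t) & forall t', a <= t' -> t' < t -> G (g t')].
Proof.
move=> ab gc oG Ga Gb.
pose S := [set t | [/\ a <= t, t <= b & ~ G (g t)]].
have Sb : S b by [].
have hS : has_inf S by split; [exists b|exists a => t []].
have ai : a <= inf S by apply: lb_le_inf => [|t []//]; exists b.
have ib : inf S <= b by apply: ge_inf => //; case: hS.
have below t' : a <= t' -> t' < inf S -> G (g t').
  move=> at' t'S; apply: contrapT => nG; have := t'S; rewrite ltNge => /negP; apply.
  apply: ge_inf; first by case: hS.
  split => //; rewrite leNgt; apply/negP => bt'.
  by move: (lt_trans (le_lt_trans ib bt') t'S); rewrite ltxx.
have nG : ~ G (g (inf S)).
  move=> Gi; have Ai : `[a, b]%classic (inf S) by rewrite /= in_itv/= ai.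
  have nGi : nbhs (g (inf S)) G by apply: open_nbhs_nbhs.
  have /subspace_continuousP/(_ (inf S) Ai) := gc.
  move=> /(_ G nGi); rewrite nbhs_simpl /within/= => /nbhs_ballP[].
  move=> del /= del0 H; suff : inf S + del <= inf S.
    by rewrite leNgt ltrDl del0.
  apply: lb_le_inf => [|t [at_ tb nG]]; first by exists b.
  have it : inf S <= t by apply: ge_inf => //; case: hS.
  rewrite leNgt; apply/negP => tS; apply: nG; apply: H; last by rewrite /= in_itv/= at_.
  rewrite /ball/= distrC ger0_norm ?subr_ge0//; lra.
exists (inf S); split => //; rewrite lt_neqAle ai andbT.
by apply/eqP => aS; apply: nG; rewrite -aS.
Qed.

Lemma within_continuous_reflect (T : metricType R) (a b : R) (g : R -> T) :
  {within `[a, b], continuous g} ->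
  {within `[a, b], continuous (fun t => g (a + b - t))}.
Proof.
move=> /within_continuous_mdistP gc; apply/within_continuous_mdistP => t /=.
rewrite in_itv/= => /andP[at_ tb] e e0.
have [|del del0 H] := gc (a + b - t) _ e e0.
  by rewrite /= in_itv/=; apply/andP; split; lra.
exists del => // t'; rewrite in_itv/= => /andP[at' t'b] tt'; apply: H.
  by rewrite /= in_itv/=; apply/andP; split; lra.
rewrite distrC (_ : _ - _ = t - t')//; ring.
Qed.

Lemma within_continuous_sub (T : topologicalType) (a b u v : R) (g : R -> T) :
  a <= u -> v <= b -> {within `[a, b], continuous g} ->
  {within `[u, v], continuous g}.
Proof.
move=> au vb; apply: continuous_subspaceW => t; rewrite /= !in_itv/= => /andP[ut tv].
by rewrite (le_trans au)//= (le_trans tv).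
Qed.

Lemma within_continuous_opp (A : set R) (h : R -> R) :
  {within A, continuous h} -> {within A, continuous (fun t => - h t)}.
Proof.
move=> /within_continuous_normP hc; apply/within_continuous_normP => t At e e0.
have [del del0 H] := hc t At e e0; exists del => // t' At' tt'.
by rewrite -opprD normrN; exact: H.
Qed.

Lemma first_hit (h : R -> R) (p q be : R) :
  p <= q -> {within `[p, q], continuous h} -> h p < be -> be <= h q ->
  exists v, [/\ p < v, v <= q, h v = be & forall t, p <= t -> t < v -> h t < be].
Proof.
move=> pq hc hp hq.
have [||v [pv vq /= /negP]] := @first_exit _ p q h [set x | x < be] pq hc _ hp.
- exact: open_lt.
- by apply/negP; rewrite -leNgt.
rewrite -leNgt => hv H; exists v; split => //.
have [||c] := @IVT R h p v be (ltW pv).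
- exact: within_continuous_sub hc.
- by rewrite min_l ?max_r ?(ltW hp) ?hv// (le_trans (ltW hp)).
rewrite in_itv/= => /andP[pc]; rewrite le_eqVlt => /predU1P[->//|cv] hcb.
by have := H _ pc cv; rewrite /= hcb ltxx.
Qed.

Lemma crossing_lt (h : R -> R) (p q al be : R) :
  p <= q -> {within `[p, q], continuous h} -> al < be -> h p <= al -> be <= h q ->
  exists u v, [/\ p <= u, u < v, v <= q, h u = al /\ h v = be &
    forall t, u < t -> t < v -> al < h t < be].
Proof.
move=> pq hc albe hp hq.
have [v [pv vq hv Hv]] := first_hit pq hc (le_lt_trans hp albe) hq.
(* The last time at level [al] before [v] is the first hit of level [- al] by the reversed and
   negated function. *)
have hc' : {within `[p, v], continuous (fun t => - h (p + v - t))}.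
  have /(@within_continuous_reflect R^o) : {within `[p, v], continuous h}.
    exact: within_continuous_sub hc.
  exact: within_continuous_opp.
have [||u [pu uv hu Hu]] := @first_hit _ p v (- al) (ltW pv) hc'.
- by rewrite ltrN2 (_ : _ - _ = v) ?hv//; ring.
- by rewrite lerN2 (_ : _ - _ = p)//; ring.
exists (p + v - u), v; split => //; [lra|lra|by split => //; lra|].
move=> t ut tv; apply/andP; split.
  have : - h (p + v - (p + v - t)) < - al by apply: Hu; lra.
  by rewrite (_ : _ - (_ - _) = t) ?ltrN2//; ring.
by apply: Hv => //; lra.
Qed.

Lemma crossing (h : R -> R) (a b p q al be : R) :
  {within `[a, b], continuous h} -> a <= p <= b -> a <= q <= b ->
  al < be -> h p <= al -> be <= h q ->
  exists u v, [/\ a <= u, u < v, v <= b,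
    (h u = al /\ h v = be) \/ (h u = be /\ h v = al) &
    forall t, u < t -> t < v -> al < h t < be].
Proof.
move=> hc /andP[ap pb] /andP[aq qb] albe hp hq.
have [pq|/ltW qp] := leP p q.
  have [u [v [pu uv vq huv H]]] :=
    crossing_lt pq (within_continuous_sub ap qb hc) albe hp hq.
  by exists u, v; split => //; [lra|lra|left].
have hc' := within_continuous_opp (within_continuous_sub aq pb hc).
have [u [v [pu uv vq huv H]]] := @crossing_lt (fun t => - h t) q p (- be) (- al)
  qp hc' (ltac:(by rewrite ltrN2)) (ltac:(by rewrite lerN2)) (ltac:(by rewrite lerN2)).
exists u, v; split => //; [lra|lra|right; lra|].
by move=> t ut tv; have /andP[] := H t ut tv; rewrite !ltrN2 => -> ->.
Qed.

End crossing.

(** * Modulus of families of curves *)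

Section density.
Context {d : measure_display} {T : measurableType d} {R : realType}.
Variable mu : {measure set T -> \bar R}.
Local Open Scope ereal_scope.

(* The density is [(\sum_k (c k)^Q 1_(B k))^(1/Q)]: unlike [sup_k (c k) 1_(B k)]
   it has an explicit integral, and unlike [\sum_k (c k) 1_(B k)] its [Q]-th power
   is additive. *)
Lemma exists_power_density (Q : R) (B : nat -> set T) (c : nat -> R) :
  (0 < Q)%R -> (forall k, measurable (B k)) -> (forall k, 0 <= c k)%R ->
  exists rho : T -> \bar R, [/\ measurable_fun setT rho, forall x, 0 <= rho x,
    forall k x, B k x -> (c k)%:E <= rho x &
    \int[mu]_x (rho x `^ Q) = \sum_(k <oo) (c k `^ Q)%:E * mu (B k)].
Proof.
move=> Q0 mB c0.
pose h k (x : T) : \bar R := (c k `^ Q)%:E * (\1_(B k) x)%:E.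
have h0 k x : 0 <= h k x by rewrite /h -EFinM lee_fin mulr_ge0// powR_ge0.
have mh k : measurable_fun [set: T] (h k).
  apply: emeasurable_funM => //; apply/measurable_EFinP.
  exact: measurable_indic.
pose S x := \sum_(k <oo) h k x.
have S0 x : 0 <= S x by apply: nneseries_ge0.
have mS : measurable_fun setT S.
  by apply: ge0_emeasurable_sum => // k x _ _; exact: h0.
exists (fun x => S x `^ Q^-1); split.
- by apply: (measurableT_comp (measurable_poweR _)) mS.
- by move=> x; rewrite poweR_ge0.
- move=> k x Bkx.
  have -> : (c k)%:E = (c k `^ Q)%:E `^ Q^-1.
    by rewrite poweR_EFin -powRrM divff ?gt_eqF// powRr1.
  apply: gt0_ler_poweR.
  + by rewrite invr_ge0 ltW.
  + by rewrite in_itv/= lee_fin powR_ge0 leey.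
  + by rewrite in_itv/= S0 leey.
  + apply: le_trans (@nneseries_lim_ge _ (h^~ x) xpredT 0 k.+1 _) => //.
    rewrite big_nat_recr//= [X in _ <= _ + X](_ : _ = (c k `^ Q)%:E).
      by rewrite leeDr// sume_ge0.
    by rewrite /h indicE mem_set// mule1.
- under eq_integral do rewrite -poweRrM mulVf ?gt_eqF// poweRe1//.
  rewrite integral_nneseries//; apply: eq_eseriesr => k _.
  rewrite /h ge0_integralZl_EFin//; last 2 first.
  + by apply/measurable_EFinP; exact: measurable_indic.
  + by rewrite powR_ge0.
  by rewrite integral_indic// setIT.
Qed.

End density.

Section modulus_basics.
Context {R : realType} {d : measure_display} {X : borelMetricType R d}.
Implicit Types (mu : {measure set X -> \bar R}) (Gamma : set (curve R X)).
Local Open Scope ereal_scope.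

Lemma open_borel_measurable (A : set X) : open A -> measurable A.
Proof. by move=> oA; rewrite measurable_borel; exact: sub_gen_smallest. Qed.

Lemma modulus_ge0 (p : R) mu Gamma : 0 <= modulus p mu Gamma.
Proof.
apply: le_ereal_inf_tmp => _ [rho _ <-]; apply: integral_ge0 => x _.
exact: poweR_ge0.
Qed.

Lemma modulus_le_integral (p : R) mu Gamma rho : admissible Gamma rho ->
  modulus p mu Gamma <= \int[mu]_x (rho x `^ p).
Proof. by move=> adm; apply: ereal_inf_lbound; exists rho. Qed.

Lemma modulus_subset (p : R) mu Gamma1 Gamma2 : Gamma1 `<=` Gamma2 ->
  modulus p mu Gamma1 <= modulus p mu Gamma2.
Proof.
move=> G12; apply: le_ereal_inf_tmp => _ [rho [mrho rho0 adm] <-].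
by apply: modulus_le_integral; split => // c Gc; apply: adm; exact: G12.
Qed.

Lemma line_integral_le (rho1 rho2 : X -> \bar R) (c : curve R X) :
  (forall x, 0 <= rho1 x) ->
  (forall x, rho1 x <= rho2 x) -> line_integral rho1 c <= line_integral rho2 c.
Proof.
move=> rho0 rho12; apply: ge_ereal_sup => _ [ab cab <-].
apply: (@le_trans _ _ (line_integral_on rho2 c ab.1 ab.2)).
  exact: ge0_le_integral_nonmeasurable.
by apply: ereal_sup_ubound; exists ab.
Qed.

(** The maximum of two admissible densities is admissible for the union, and its [p]-th power is at
    most the sum of their [p]-th powers. *)
Lemma modulusU (p : R) mu Gamma1 Gamma2 : (0 <= p)%R ->
  modulus p mu (Gamma1 `|` Gamma2) <= modulus p mu Gamma1 + modulus p mu Gamma2.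
Proof.
move=> p0.
have key rho1 rho2 : admissible Gamma1 rho1 -> admissible Gamma2 rho2 ->
    modulus p mu (Gamma1 `|` Gamma2) <=
    \int[mu]_x (rho1 x `^ p) + \int[mu]_x (rho2 x `^ p).
  move=> [m1 r10 a1] [m2 r20 a2].
  apply: (@le_trans _ _ (\int[mu]_x ((maxe (rho1 x) (rho2 x)) `^ p))).
    apply: modulus_le_integral; split.
    - exact: measurable_maxe.
    - by move=> x; rewrite le_max r10.
    - move=> c [G1|G2] lr.
      + by apply: le_trans (a1 _ G1 lr) _; apply: line_integral_le => // x; rewrite le_max lexx.
      + by apply: le_trans (a2 _ G2 lr) _; apply: line_integral_le => // x; rewrite le_max lexx orbT.
  rewrite -ge0_integralD//.
  - apply: ge0_le_integral_nonmeasurable => x _; first exact: poweR_ge0.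
    rewrite /maxe; case: ifPn => _.
      by rewrite leeDr// poweR_ge0.
    by rewrite leeDl// poweR_ge0.
  - by move=> x _; exact: poweR_ge0.
  - by apply: (measurableT_comp (measurable_poweR _)) m1.
  - by move=> x _; exact: poweR_ge0.
  - by apply: (measurableT_comp (measurable_poweR _)) m2.
have [f1|] := boolP (modulus p mu Gamma1 \is a fin_num); last first.
  rewrite ge0_fin_numE ?modulus_ge0// -leNgt leye_eq => /eqP ->.
  by rewrite addye ?leey// gt_eqF// (lt_le_trans _ (modulus_ge0 _ _ _))// ltNy0.
have [f2|] := boolP (modulus p mu Gamma2 \is a fin_num); last first.
  rewrite ge0_fin_numE ?modulus_ge0// -leNgt leye_eq => /eqP ->.
  by rewrite addey ?leey// gt_eqF// (lt_le_trans _ (modulus_ge0 _ _ _))// ltNy0.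
apply/lee_addgt0Pr => e e0.
have e2 : (0 < e / 2)%R by rewrite divr_gt0.
have [_ [rho1 a1 <-] l1] := lb_ereal_inf_adherent e2 f1.
have [_ [rho2 a2 <-] l2] := lb_ereal_inf_adherent e2 f2.
apply: le_trans (key _ _ a1 a2) _.
apply: (@le_trans _ _ ((modulus p mu Gamma1 + (e / 2)%:E) + (modulus p mu Gamma2 + (e / 2)%:E))).
  by apply: leeD; exact: ltW.
by rewrite addeACA -EFinD -splitr.
Qed.

End modulus_basics.

(** * Line integrals bounded below by crossings of spherical shells *)

Section shells.
Context {R : realType} {T : metricType R}.

(** A curve with points on both sides of a shell crosses it, and the crossing is at least as long as
    the shell is wide since the distance to [z i] is 1-Lipschitz. Disjoint shells are crossed at
    disjoint times, so the contributions add up. The explicit densities below are proved admissible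
    through this estimate. *)
Lemma shells_line_integral (rho : T -> \bar R) (c : curve R T) (a b : R)
    (I : eqType) (s : seq I) (z : I -> T) (al be k : I -> R) :
  (forall x, 0 <= rho x)%E ->
  a <= b -> cdom c = `[a, b]%classic -> locally_rectifiable c -> uniq s ->
  (forall i, i \in s -> 0 <= k i /\ al i < be i) ->
  (forall i, i \in s -> exists2 p, a <= p <= b & mdist (c p) (z i) <= al i) ->
  (forall i, i \in s -> exists2 q, a <= q <= b & be i <= mdist (c q) (z i)) ->
  (forall i t, i \in s -> a <= t <= b -> al i < mdist (c t) (z i) < be i ->
    ((k i)%:E <= rho (c t))%E) ->
  (forall i j x, i \in s -> j \in s -> al i < mdist x (z i) < be i ->
    al j < mdist x (z j) < be j -> i = j) ->
  ((\sum_(i <- s) k i * (be i - al i))%:E <= line_integral rho c)%E.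
Proof.
move=> rho0 ab domc lr us kab inn out krho triv.
have cc : {within `[a, b], continuous c} by have := @cmap_continuous _ _ c; rewrite domc.
have ca : cdom c a by rewrite domc /= in_itv/= lexx.
have cb : cdom c b by rewrite domc /= in_itv/= lexx andbT.
have fin : (arc_length c a b < +oo)%E by exact: lr.
have /choice[uv Huv] : forall i, exists uv : R * R, i \in s ->
    [/\ a <= uv.1, uv.1 < uv.2, uv.2 <= b,
     `|mdist (c uv.1) (z i) - mdist (c uv.2) (z i)| = be i - al i &
     forall t, uv.1 < t -> t < uv.2 -> al i < mdist (c t) (z i) < be i].
  move=> i; have [si|_] := boolP (i \in s); last by exists (0, 0).
  have [p pab hp] := inn _ si; have [q qab hq] := out _ si.
  have albe := (kab _ si).2.
  have [u [v [au uv vb huv H]]] :=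
    crossing (@within_continuous_mdist _ _ _ _ (z i) cc) pab qab albe hp hq.
  exists (u, v) => _; split => //=.
  case: huv => -[-> ->]; last by rewrite ger0_norm; lra.
  by rewrite distrC ger0_norm; lra.
apply: (@le_trans _ _ (line_integral_on rho c a b)); last first.
  by apply: ereal_sup_ubound; exists (a, b).
apply: le_trans (@line_integral_on_ge _ _ rho c a b I s k (fun i => (uv i).1)
   (fun i => (uv i).2) rho0 ab cc fin us _ _ _); last first.
- move=> i j t si sj ut tv ut' tv'.
  have [_ _ _ _ Hi] := Huv _ si; have [_ _ _ _ Hj] := Huv _ sj.
  by apply: (triv i j (c t)) => //; [apply: Hi|apply: Hj].
- move=> i t si ut tv; have [au _ vb _ Hi] := Huv _ si.
  apply: krho => //; last exact: Hi.
  by rewrite (le_trans au (ltW ut)) (le_trans (ltW tv)).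
- move=> i si; have [au uv' vb _ Hi] := Huv _ si.
  by split => //; [exact: (kab _ si).1|exact: ltW].
rewrite lee_fin [leLHS]big_seq [leRHS]big_seq; apply: ler_sum => i si.
apply: ler_wpM2l; first exact: (kab _ si).1.
have [_ _ _ <- _] := Huv _ si; exact: mdist_triangle_abs.
Qed.

End shells.

Section point_modulus.
Context {R : realType} {d : measure_display} {X : borelMetricType R d}.
Variables (Q : R) (mu : {measure set X -> \bar R}).

(** The excursion to distance [eta] excludes constant curves, along which every line integral
    vanishes and whose presence would make the modulus infinite. *)
Definition curves_through (p : X) (eta : R) : set (curve R X) :=
  [set c | exists a b, [/\ a <= b, cdom c = `[a, b]%classic,
    exists2 t, a <= t <= b & c t = p &
    exists2 t, a <= t <= b & eta <= mdist (c t) p]].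

(* The curves cross the [n] dyadic annuli below the scale [eta]; a density
   comparable to [1 / (n |x - p|)] gives each of them the length [1 / n], at the
   cost [n * n^(-Q)]. *)
Lemma modulus_curves_through_le (p : X) (C eta : R) (n : nat) : 1 < Q ->
  0 <= C -> 0 < eta -> (0 < n)%N ->
  (forall r : R, 0 < r -> r <= eta -> (mu (ball p r) <= (C * r `^ Q)%:E)%E) ->
  (modulus Q mu (curves_through p eta) <= (n%:R * (C * (2 / n%:R) `^ Q))%:E)%E.
Proof.
move=> Q1 C0 eta0 n0 mass.
have Q0 : 0 < Q by lra.
have n0' : 0 < n%:R :> R by rewrite ltr0n.
pose be (k : nat) : R := eta * 2^-1 ^+ k.
have be0 k : 0 < be k by rewrite mulr_gt0// exprn_gt0// invr_gt0.
have beS k : be k.+1 = be k / 2 by rewrite /be exprSr mulrA.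
have be_le i j : (i <= j)%N -> be j <= be i.
  move=> ij; rewrite ler_wpM2l ?(ltW eta0)//.
  by apply: ler_wiXn2l => //; rewrite invf_le1// ler1n.
(* The [k]-th shell has width [be k / 2], so this value contributes exactly the length [1 / n]. *)
pose c (k : nat) : R := if (k < n)%N then 2 / (n%:R * be k) else 0.
have c0 k : 0 <= c k.
  rewrite /c; case: ifP => // _; rewrite divr_ge0// mulr_ge0//; exact: ltW.
have mB k : measurable (ball p (be k)).
  by apply: open_borel_measurable; exact: open_ball_metric.
have [rho [mrho rho0 rhoc intrho]] := exists_power_density mu Q0 mB c0.
apply: (@le_trans _ _ (\int[mu]_x (rho x `^ Q))%E).
  apply: modulus_le_integral; split => // g [a [b [ab domg [t0 t0ab gt0] [t1 t1ab gt1]]]] lr.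
  apply: le_trans (@shells_line_integral _ _ rho g a b nat (iota 0 n) (fun=> p)
    (fun k => be k.+1) be c rho0 ab domg lr (iota_uniq _ _) _ _ _ _ _).
  - rewrite (eq_big_seq (fun=> n%:R^-1)); last first.
      move=> k; rewrite mem_iota add0n => /= kn; rewrite /c kn beS.
      by have := be0 k; have := n0'; move=> *; field; rewrite !gt_eqF.
    by rewrite big_const_seq count_predT size_iota iter_addr addr0 -(mulr_natr n%:R^-1) mulVf ?gt_eqF.
  - by move=> k _; split => //; rewrite beS; have := be0 k; lra.
  - by move=> k _; exists t0 => //; rewrite gt0 mdistxx ltW.
  - move=> k _; exists t1 => //; apply: le_trans gt1.
    by rewrite -[leRHS]mulr1 -[X in eta * X](expr0 2^-1) be_le.
  - move=> k t _ _ /andP[_ h]; apply: rhoc; apply/ballP; by rewrite metric_sym.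
  - have aux i j x : (i < j)%N -> be i.+1 < mdist x p < be i ->
        be j.+1 < mdist x p < be j -> False.
      move=> ij /andP[h _] /andP[_ h']; have := be_le _ _ ij; lra.
    move=> i j x _ _ h h'; case: (ltngtP i j) => // ij; exfalso.
      exact: aux ij h h'.
    exact: aux ij h' h.
rewrite intrho (@nneseries_split _ _ 0 n); last first.
  by move=> k _; rewrite mule_ge0// lee_fin powR_ge0.
rewrite add0n [X in (_ + X)%E]eseries0 ?adde0; last first.
  move=> k nk _; rewrite /c ltnNge nk/= powR0 ?mul0e// gt_eqF//.
apply: (@le_trans _ _ (\sum_(0 <= k < n) (C * (2 / n%:R) `^ Q)%:E)%E).
  rewrite big_nat [leRHS]big_nat; apply: lee_sum => k /andP[_ kn].
  apply: (@le_trans _ _ ((c k `^ Q)%:E * (C * be k `^ Q)%:E)%E).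
    apply: lee_wpmul2l; first by rewrite lee_fin powR_ge0.
    by apply: mass => //; rewrite -[leRHS]mulr1 -[X in eta * X](expr0 2^-1) be_le.
  rewrite -EFinM lee_fin mulrCA -powRM//; last exact: ltW.
  rewrite (_ : c k * be k = 2 / n%:R)//.
  rewrite /c kn; have := be0 k; have := n0'; move=> *; field.
  by rewrite !gt_eqF.
by rewrite sumEFin big_const_nat iter_addr addr0 subn0 -(mulr_natl (C * _)).
Qed.

(** The preceding bound is a constant times [n] to the power [1 - Q], which tends to 0 because
    [Q > 1]. Lowering [eta] to at most [r0] only enlarges the family. *)
Lemma modulus_curves_through (p : X) (C r0 eta : R) : 1 < Q ->
  0 <= C -> 0 < r0 -> 0 < eta ->
  (forall r : R, 0 < r -> r <= r0 -> (mu (ball p r) <= (C * r `^ Q)%:E)%E) ->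
  modulus Q mu (curves_through p eta) = 0%E.
Proof.
move=> Q1 C0 r00 eta0 mass; apply/eqP; rewrite eq_le modulus_ge0 andbT.
pose eta' := Num.min eta r0.
have eta'0 : 0 < eta' by rewrite lt_min eta0.
apply: (@le_trans _ _ (modulus Q mu (curves_through p eta'))).
  apply: modulus_subset => c [a [b [ab domc ht [t tab htt]]]].
  exists a, b; split => //; exists t => //; apply: le_trans htt.
  by rewrite ge_min lexx.
apply/lee_addgt0Pr => e e0; rewrite add0e.
have Q10 : 0 < Q - 1 by lra.
pose K := C * 2 `^ Q.
have K0 : 0 <= K by rewrite mulr_ge0// powR_ge0.
pose n := (Num.truncn ((K / e) `^ (Q - 1)^-1)).+1.
have nn : (K / e) `^ (Q - 1)^-1 <= n%:R by apply: ltW; exact: truncnS_gt.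
have n0 : 0 < n%:R :> R by rewrite ltr0n.
apply: le_trans (@modulus_curves_through_le p C eta' n Q1 C0 eta'0 isT _) _.
  by move=> r rr re; apply: mass => //; apply: le_trans re _; rewrite ge_min lexx orbT.
have n0i : 0 <= (n%:R)^-1 :> R by rewrite invr_ge0 ltW.
rewrite lee_fin powRM//.
rewrite -(powR_inv1 (ltW n0)) -powRrM mulN1r.
have -> : n%:R * (C * (2 `^ Q * n%:R `^ (- Q))) = K * n%:R `^ (1 - Q).
  rewrite powRD ?powRr1 ?(ltW n0)//; last by rewrite (gt_eqF n0) implybT.
  rewrite /K; ring.
rewrite (_ : 1 - Q = - (Q - 1)); last by ring.
rewrite powRN ler_pdivrMr ?powR_gt0// mulrC -ler_pdivrMr//.
have -> : K / e = ((K / e) `^ (Q - 1)^-1) `^ (Q - 1).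
  by rewrite -powRrM mulVf ?gt_eqF// powRr1// divr_ge0// ltW.
apply: ge0_ler_powR => //; [exact: ltW|by rewrite nnegrE powR_ge0|by rewrite nnegrE ltW].
Qed.

End point_modulus.

Section continua.
Context {R : realType} {T : metricType R}.

Lemma continuum_path_image (g : R -> T) (u v : R) : u <= v ->
  {within `[u, v], continuous g} -> continuum (g @` `[u, v]).
Proof.
move=> uv gc; split.
- by exists (g u), u => //=; rewrite in_itv/= lexx.
- by apply: continuous_compact => //; exact: segment_compact.
- by apply: connected_continuous_connected => //; exact: segment_connected.
Qed.

Lemma short_path (x y : T) (rho : R) : pathwise_connected R T ->
  0 < rho -> rho <= mdist x y ->
  exists (g : R -> T) (v : R), [/\ 0 <= v, {within `[0, v], continuous g}, g 0 = x,
    forall t, 0 <= t <= v -> mdist x (g t) <= rho & mdist x (g v) = rho].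
Proof.
move=> /(_ x y)[g [gc g0 g1]] rho0 rhoxy.
have [||v [v0 v1 hv H]] := @first_hit _ (fun t => mdist (g t) x) 0 1 rho ler01
    (within_continuous_mdist gc).
- by rewrite g0 mdistxx.
- by rewrite g1 metric_sym.
exists g, v; split => //; first exact: ltW.
- exact: within_continuous_sub gc.
- move=> t /andP[t0]; rewrite le_eqVlt => /predU1P[->|tv].
    by rewrite metric_sym hv.
  by rewrite metric_sym ltW// H.
- by rewrite metric_sym.
Qed.

Lemma small_continuum (x y : T) (rho : R) : pathwise_connected R T ->
  0 < rho -> rho <= mdist x y ->
  exists K : set T, [/\ continuum K, K x, forall z, K z -> mdist x z <= rho &
    exists2 z, K z & mdist x z = rho].
Proof.
move=> pc rho0 rhoxy; have [g [v [v0 gc g0 H gv]]] := short_path pc rho0 rhoxy.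
exists (g @` `[0, v]); split.
- exact: continuum_path_image.
- by exists 0 => //=; rewrite in_itv/= lexx.
- by move=> _ [t /= + <-]; rewrite in_itv/= => /H.
- by exists (g v) => //; exists v => //=; rewrite in_itv/= lexx v0.
Qed.

Lemma nondegenerateP (K : set T) (x y : T) : continuum K -> K x -> K y ->
  0 < mdist x y -> nondegenerate_continuum K.
Proof.
by move=> cK Kx Ky xy; split => //; exists x, y; split => //; apply/eqP; rewrite -mdist_gt0.
Qed.

End continua.

(** * Consequences of the Loewner condition *)

Section loewner.
Context {R : realType} {d : measure_display} {X : borelMetricType R d}.
Variables (Q : R) (mu : {measure set X -> \bar R}) (psi : R -> R).

(** Explicit points bound the diameters from below and the distance from above, which is all that
    the Loewner condition asks. *)
Lemma loewner_bound_points (A V E F : set X) (e1 e2 f1 f2 : X) (t : R) :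
  loewner_bound Q mu psi A V -> 0 < t -> continuum E -> continuum F ->
  E `&` F = set0 -> E `<=` A -> F `<=` A -> E e1 -> E e2 -> F f1 -> F f2 ->
  0 < mdist e1 e2 -> 0 < mdist f1 f2 ->
  mdist e1 f1 <= t * mdist e1 e2 -> mdist e1 f1 <= t * mdist f1 f2 ->
  ((psi t)%:E <= modulus Q mu (joining_curves E F V))%E.
Proof.
move=> lb t0 cE cF EF EA FA Ee1 Ee2 Ff1 Ff2 e12 f12 h1 h2.
apply: lb => //; [exact: nondegenerateP e12|exact: nondegenerateP f12|].
have hE : ((mdist e1 e2)%:E <= set_diam E)%E.
  by apply: ereal_sup_ubound; exists (e1, e2).
have hF : ((mdist f1 f2)%:E <= set_diam F)%E.
  by apply: ereal_sup_ubound; exists (f1, f2).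
apply: (@le_trans _ _ (mdist e1 f1)%:E).
  by apply: ereal_inf_lbound; exists (e1, f1).
apply: (@le_trans _ _ (t%:E * mine (mdist e1 e2)%:E (mdist f1 f2)%:E)%E).
  rewrite -EFin_min -EFinM lee_fin /Num.min; case: ifP => //.
apply: lee_wpmul2l; first by rewrite lee_fin ltW.
by rewrite le_min !ge_min hE hF orbT.
Qed.

(** The density equal to the inverse of the width of the shell on [A], and to 0 elsewhere, is
    admissible. *)
Lemma modulus_shell_le (Gamma : set (curve R X)) (A : set X) (z : X) (al be : R) :
  0 < Q -> measurable A -> al < be ->
  (forall c, Gamma c -> exists a b, [/\ a <= b, cdom c = `[a, b]%classic,
    exists2 p, a <= p <= b & mdist (c p) z <= al,
    exists2 q, a <= q <= b & be <= mdist (c q) z &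
    forall t, a <= t <= b -> al < mdist (c t) z < be -> A (c t)]) ->
  (modulus Q mu Gamma <= (((be - al)^-1) `^ Q)%:E * mu A)%E.
Proof.
move=> Q0 mA albe H; have ba0 : 0 < be - al by lra.
pose rho x : \bar R := ((be - al)^-1 * \1_A x)%:E.
apply: (@le_trans _ _ (\int[mu]_x (rho x `^ Q))%E).
  apply: modulus_le_integral; split.
  - apply/measurable_EFinP; apply: measurable_funM => //; exact: measurable_indic.
  - by move=> x; rewrite lee_fin mulr_ge0// invr_ge0 ltW.
  - move=> c /H[a [b [ab domc hp hq hA]]] lr.
    apply: le_trans (@shells_line_integral _ _ rho c a b unit [:: tt] (fun=> z)
      (fun=> al) (fun=> be) (fun=> (be - al)^-1) _ ab domc lr _ _ _ _ _ _) => //.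
    + by rewrite big_seq1 mulVf ?gt_eqF.
    + by move=> x; rewrite lee_fin mulr_ge0// invr_ge0 ltW.
    + by move=> _ _; rewrite invr_ge0 ltW.
    + move=> _ t _ tab h; rewrite lee_fin indicE mem_set ?mulr1//; exact: hA.
    + by move=> [] [].
rewrite (_ : (\int[mu]_x _)%E = (\int[mu]_x ((((be - al)^-1) `^ Q)%:E * (\1_A x)%:E))%E); last first.
  apply: eq_integral => x _; rewrite /rho poweR_EFin -EFinM indicE.
  by case: (x \in A); rewrite /= ?mulr1// !mulr0 powR0 ?gt_eqF.
rewrite ge0_integralZl_EFin//; last 2 first.
- by apply/measurable_EFinP; exact: measurable_indic.
- by rewrite powR_ge0.
by rewrite integral_indic// setIT.
Qed.

(* The curves joining two continua of size comparable to [s] in [ball y s] all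
   have length at least [lam * s / 4]; compare the resulting upper bound of their
   modulus with the Loewner bound. *)
Lemma ball_mass_ge (y w : X) (lam s : R) : 0 < Q -> pathwise_connected R X ->
  0 < lam <= 1 -> 0 < s -> s <= mdist y w ->
  loewner_bound Q mu psi (ball y (lam * s)) (ball y s) ->
  ((psi 4 * (lam * s / 4) `^ Q)%:E <= mu (ball y s))%E.
Proof.
move=> Q0 pc /andP[lam0 lam1] s0 syw lb.
(* [E] lies within [m] of [y], and [F] between the distances [3 * m] and [5 * m], both inside the
   ball of radius [8 * m]. Their distance is at most [4 * m] and their diameters at least [m],
   whence [psi 4]; the shell from [m] to [3 * m] has width [lam * s / 4]. *)
pose m := lam * s / 8.
have m0 : 0 < m by rewrite divr_gt0// mulr_gt0.
have ls : lam * s <= s by rewrite ger_pMl.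
have ms : lam * s = 8 * m by rewrite /m; lra.
have [E [cE Ey HE [e Ee ye]]] : exists K : set X, [/\ continuum K, K y,
    forall z, K z -> mdist y z <= m & exists2 z, K z & mdist y z = m].
  by apply: (small_continuum (y := w)) => //; lra.
have [g [v [v0 _ _ _ gv]]] : exists (g : R -> X) (v : R),
   [/\ 0 <= v, {within `[0, v], continuous g}, g 0 = y,
    forall t, 0 <= t <= v -> mdist y (g t) <= 4 * m & mdist y (g v) = 4 * m].
  by apply: (short_path (y := w)) => //; lra.
have [F [cF Fy HF [f Ff yf]]] : exists K : set X, [/\ continuum K, K (g v),
    forall z, K z -> mdist (g v) z <= m & exists2 z, K z & mdist (g v) z = m].
  by apply: (small_continuum (y := y)) => //; rewrite metric_sym; lra.
have HF' z : F z -> 3 * m <= mdist y z /\ mdist y z <= 5 * m.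
  move=> /HF h; have := metric_triangle y (g v) z; have := metric_triangle y z (g v).
  by rewrite (metric_sym z); lra.
have : ((psi 4)%:E <= modulus Q mu (joining_curves E F (ball y s)))%E.
  apply: (@loewner_bound_points _ _ E F y e (g v) f 4 lb) => //.
  - rewrite -subset0 => z [/HE h1 /HF'[h2 _]]; lra.
  - by move=> z /HE h; apply/ballP; lra.
  - by move=> z /HF' h; apply/ballP; lra.
  - by rewrite ye.
  - by rewrite yf.
  - by rewrite ye gv.
  - by rewrite yf gv.
have : (modulus Q mu (joining_curves E F (ball y s)) <=
     (((3 * m - m)^-1) `^ Q)%:E * mu (ball y s))%E.
  apply: (@modulus_shell_le _ _ y) => //.
  - by apply: open_borel_measurable; exact: open_ball_metric.
  - lra.
  move=> c [cV [a [b [ab domc ends]]]].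
  have aab : a <= a <= b by rewrite lexx.
  have bab : a <= b <= b by rewrite ab lexx.
  exists a, b; split => //.
  - case: ends => -[h1 h2]; [exists a => //|exists b => //]; rewrite metric_sym; exact: HE.
  - by case: ends => -[h1 h2]; [exists b => //|exists a => //]; rewrite metric_sym; apply HF'.
  - by move=> t tab _; apply: cV; exists t => //; rewrite domc /= in_itv.
move=> h1 h2; have {h1 h2} := le_trans h2 h1.
rewrite (_ : 3 * m - m = lam * s / 4); last by rewrite /m; lra.
have K0 : 0 < lam * s / 4 by rewrite divr_gt0// mulr_gt0.
move=> h; rewrite EFinM muleC.
apply: (@le_trans _ _ (((lam * s / 4) `^ Q)%:E * ((((lam * s / 4)^-1) `^ Q)%:E * mu (ball y s)))%E).
  by apply: lee_wpmul2l => //; rewrite lee_fin powR_ge0.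
have K1 : 0 <= (lam * s / 4)^-1 by rewrite invr_ge0 ltW.
rewrite muleA -EFinM -(powRM _ (ltW K0) K1).
by rewrite divff ?gt_eqF// powR1 mul1e.
Qed.

(** A small continuum around [z] inside [G] and one around [w] outside [G] are joined in [ball z0 s]
    by a family of positive modulus. Its members through [p] have modulus zero, so some member
    avoids [p]. *)
Lemma join_avoiding (z0 p z w : X) (G : set X) (lam s C r0 : R) :
  1 < Q -> pathwise_connected R X -> 0 < lam <= 1 -> 0 < s ->
  (forall t, 0 < t -> 0 < psi t) ->
  loewner_bound Q mu psi (ball z0 (lam * s)) (ball z0 s) ->
  0 <= C -> 0 < r0 ->
  (forall r : R, 0 < r -> r <= r0 -> (mu (ball p r) <= (C * r `^ Q)%:E)%E) ->
  open G -> ball z0 (lam * s) z -> ball z0 (lam * s) w ->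
  G z -> ~ G w -> p <> z -> p <> w ->
  exists (a b : R) (g : R -> X), [/\ a <= b, {within `[a, b], continuous g},
    G (g a), ~ G (g b) & forall t, a <= t <= b -> ball z0 s (g t) /\ g t <> p].
Proof.
move=> Q1 pc /andP[lam0 lam1] s0 psi0 lb C0 r00 mass oG zB wB Gz Gw pz pw.
have ls : lam * s <= s by rewrite ger_pMl.
have zw : 0 < mdist z w by rewrite mdist_gt0; apply/eqP => zw; apply: Gw; rewrite -zw.
have pz0 : 0 < mdist p z by rewrite mdist_gt0; apply/eqP.
have pw0 : 0 < mdist p w by rewrite mdist_gt0; apply/eqP.
have [e1 e10 he1] : exists2 e : R, 0 < e & ball z e `<=` G.
  have : nbhs z G by apply: open_nbhs_nbhs.
  by move=> /nbhs_ballP[e /= e0 H]; exists e.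
move: zB wB => /ballP zB /ballP wB.
(* The bounds keep [E] in [G], in the ball of radius [lam * s] and away from [p]; the last one lets
   a path from [z] to [w] reach the distance [r1]. *)
pose r1 := Num.min (e1 / 2) (Num.min ((lam * s - mdist z0 z) / 2)
   (Num.min (mdist p z / 2) (mdist z w))).
have r10 : 0 < r1 by rewrite !lt_min zw !divr_gt0// subr_gt0.
have [r1a r1b r1c r1d] : [/\ r1 <= e1 / 2, r1 <= (lam * s - mdist z0 z) / 2,
   r1 <= mdist p z / 2 & r1 <= mdist z w].
  by rewrite /r1 !ge_min !lexx ?orbT.
pose r2 := Num.min ((lam * s - mdist z0 w) / 2)
   (Num.min (mdist p w / 2) (mdist z w)).
have r20 : 0 < r2 by rewrite !lt_min zw !divr_gt0// subr_gt0.
have [r2b r2c r2d] : [/\ r2 <= (lam * s - mdist z0 w) / 2,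
   r2 <= mdist p w / 2 & r2 <= mdist z w].
  by rewrite /r2 !ge_min !lexx ?orbT.
have [E [cE Ez HE [e Ee ye]]] := small_continuum pc r10 r1d.
have [|g [v [v0 gc gw Hg gv]]] := @short_path _ _ w z r2 pc r20; first by rewrite metric_sym.
have gB t : 0 <= t <= v -> ball z0 (lam * s) (g t) /\ g t <> p.
  move=> tv; have h := Hg t tv; split.
    by apply/ballP; have := metric_triangle z0 w (g t); lra.
  by move=> gtp; move: h; rewrite gtp metric_sym; lra.
(* If the short path from [w] meets [G], its reversed beginning is already the desired path;
   otherwise its image [F] is disjoint from [E]. *)
have [[t t0v Ggt]|nG] := pselect (exists2 t, 0 <= t <= v & G (g t)).
  have /andP[t0 tv] := t0v.
  exists 0, t, (fun u => g (0 + t - u)); split => //.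
  - by apply: within_continuous_reflect; exact: within_continuous_sub gc.
  - by rewrite subr0 add0r.
  - by rewrite (_ : 0 + t - t = 0) ?gw//; ring.
  - move=> u /andP[u0 ut]; have [|/ballP h1 h2] := gB (0 + t - u); first lra.
    by split => //; apply/ballP; lra.
pose F := g @` `[0, v].
have cF : continuum F by exact: continuum_path_image.
have Fnear x : F x -> mdist w x <= r2 by move=> [t /= +  <-]; rewrite in_itv/= => /Hg.
have EG : E `<=` G by move=> x /HE h; apply: he1; apply/ballP; lra.
(* Both [t * r1] and [t * r2] are at least the distance from [z] to [w]. *)
pose t := mdist z w / r1 + mdist z w / r2.
have t0 : 0 < t by rewrite addr_gt0// divr_gt0.
have low : ((psi t)%:E <= modulus Q mu (joining_curves E F (ball z0 s)))%E.
  apply: (@loewner_bound_points _ _ E F z e w (g v) t lb) => //.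
  - rewrite -subset0 => x [/EG Gx [u + gux]].
    rewrite /= in_itv/= => uv; apply: nG; exists u => //; by rewrite gux.
  - by move=> x /HE h; apply/ballP; have := metric_triangle z0 z x; lra.
  - by move=> _ [u + <-]; rewrite /= in_itv/= => /gB[].
  - by exists 0 => //=; rewrite in_itv/= lexx.
  - by exists v => //=; rewrite in_itv/= lexx v0.
  - by rewrite ye.
  - by rewrite gv.
  - rewrite ye /t mulrDl divfK ?gt_eqF// lerDl mulr_ge0//; [|exact: ltW].
    by rewrite divr_ge0// ltW.
  - rewrite gv /t mulrDl addrC divfK ?gt_eqF// lerDl mulr_ge0//; [|exact: ltW].
    by rewrite divr_ge0// ltW.
have [[c [[cV [a [b [ab domc ends]]]] cp]]|nc] := pselect (exists c : curve R X,
    joining_curves E F (ball z0 s) c /\ forall t, cdom c t -> c t <> p); last first.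
  exfalso; have := psi0 _ t0; apply/negP; rewrite -leNgt -lee_fin.
  apply: le_trans low _.
  pose eta := Num.min (mdist p z / 2) (mdist p w / 2).
  have eta0 : 0 < eta by rewrite lt_min !divr_gt0.
  apply: (@le_trans _ _ (modulus Q mu (curves_through p eta))); last first.
    by rewrite (modulus_curves_through Q1 C0 r00 eta0 mass).
  apply: modulus_subset => c jc.
  have [t1 ct1 c1] : exists2 t, cdom c t & c t = p.
    apply: contrapT => h; apply: nc; exists c; split => // t1 ct1 c1.
    by apply: h; exists t1.
  case: jc => cV [a [b [ab domc ends]]].
  exists a, b; split => //.
    by exists t1 => //; move: ct1; rewrite domc /= in_itv.
  case: ends => -[ha _]; exists a; rewrite ?lexx//.
    rewrite ge_min; apply/orP; left; have := HE _ ha.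
    by have := metric_triangle p (c a) z; rewrite (metric_sym (c a) z) (metric_sym p (c a)); lra.
  rewrite ge_min; apply/orP; right; have := Fnear _ ha.
  by have := metric_triangle p (c a) w; rewrite (metric_sym (c a) w) (metric_sym p (c a)); lra.
have cc : {within `[a, b], continuous c} by have := @cmap_continuous _ _ c; rewrite domc.
have cB t1 : a <= t1 <= b -> ball z0 s (c t1) /\ c t1 <> p.
  move=> h; have dt : cdom c t1 by rewrite domc /= in_itv.
  by split; [apply: cV; exists t1|exact: cp].
have FG x : F x -> ~ G x.
  by move=> [u + <-]; rewrite /= in_itv/= => uv Gu; apply: nG; exists u.
case: ends => -[h1 h2].
  by exists a, b, c; split => //; [exact: EG|exact: FG].
exists a, b, (fun u => c (a + b - u)); split => //.
- exact: within_continuous_reflect.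
- by rewrite (_ : a + b - a = b); [exact: EG|ring].
- by rewrite (_ : a + b - b = a); [exact: FG|ring].
- by move=> u /andP[au ub]; apply: cB; lra.
Qed.

End loewner.

(** * Covering lemmas *)

Section vitali.
Context {R : realType} {T : metricType R}.

Definition disjoint_balls (S : set T) (r : T -> R) :=
  forall x y, S x -> S y -> ball x (r x) `&` ball y (r y) !=set0 -> x = y.

(* Zorn's lemma is applied to the disjoint subfamilies such that each ball which
   meets one of them also meets a member of at least half its own radius. *)
Lemma vitali_covering (D : set T) (r : T -> R) (M : R) :
  (forall x, D x -> 0 < r x <= M) ->
  exists S, [/\ S `<=` D, disjoint_balls S r &
    forall x, D x -> exists2 y, S y &
      ball x (r x) `&` ball y (r y) !=set0 /\ r x <= 2 * r y].
Proof.
move=> rD.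
have self x : D x -> ball x (r x) x.
  by move=> /rD/andP[r0 _]; apply/ballP; rewrite mdistxx.
pose meets x y := ball x (r x) `&` ball y (r y) !=set0.
have meetsC x y : meets x y -> meets y x by case=> z [? ?]; exists z.
pose P S := [/\ S `<=` D, disjoint_balls S r &
  forall x y, D x -> S y -> meets x y ->
  exists2 y', S y' & meets x y' /\ r x <= 2 * r y'].
have [F FP totF|S [[SD Sdisj SP] maxS]] := @Zorn_bigcup _ P.
  split.
  - by move=> x [A FA Ax]; have [AD _ _] := FP _ FA; exact: AD.
  - move=> x y [A FA Ax] [B FB By].
    have [_ Ad _] := FP _ FA; have [_ Bd _] := FP _ FB.
    by case: (totF _ _ FA FB) => H; [apply: Bd => //; exact: H|apply: Ad => //; exact: H].
  - move=> x y Dx [A FA Ay] xy; have [_ _ AP] := FP _ FA.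
    by have [y' Ay' H] := AP _ _ Dx Ay xy; exists y' => //; exists A.
exists S; split => // x Dx.
have [[y Sy xy]|nmeet] := pselect (exists2 y, S y & meets x y).
  exact: SP Dx Sy xy.
exfalso.
(* A member of [N] with radius above half the supremum can be added to [S]: any ball that meets it
   but no member of [S] is in [N], hence has less than twice its radius. *)
pose N := [set z | D z /\ forall y, S y -> ~ meets z y].
have Nx : N x by split => // y Sy xy; apply: nmeet; exists y.
have hs : has_sup (r @` N).
  split; first by exists (r x), x.
  by exists M => _ [z [Dz _] <-]; have /andP[] := rD _ Dz.
have sup0 : 0 < sup (r @` N).
  have /andP[rx0 _] := rD _ Dx; apply: lt_le_trans rx0 _.
  by apply: sup_upper_bound => //; exists x.
have half0 : 0 < sup (r @` N) / 2 by rewrite divr_gt0.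
have [_ [z [Dz Nz] <-] rz] := sup_adherent half0 hs.
apply: (maxS (S `|` [set z])).
  split; first by move=> y; left.
  move=> /(_ z) h; have Sz : S z by apply: h; right.
  by apply: (Nz _ Sz); exists z; split; exact: self.
split.
- by move=> y [/SD//|->].
- move=> y y' [Sy|->] [Sy'|->] h //.
  + exact: Sdisj.
  + by exfalso; apply: (Nz _ Sy); exact: meetsC.
  + by exfalso; apply: (Nz _ Sy').
- move=> w y Dw Sy wy.
  have [[y' Sy' wy']|nw] := pselect (exists2 y, S y & meets w y).
    by have [v Sv Hv] := SP _ _ Dw Sy' wy'; exists v => //; left.
  case: Sy => [Sy|zy]; first by exfalso; apply: nw; exists y.
  rewrite zy in wy; exists z; first by right.
  split => //; have : r w <= sup (r @` N).
    apply: sup_upper_bound => //; exists w => //; split => // y' Sy' wy'.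
    by apply: nw; exists y'.
  lra.
Qed.

Lemma disjoint_balls_countable (S : set T) (r : T -> R) :
  separable_space T -> (forall x, S x -> 0 < r x) -> disjoint_balls S r ->
  countable S.
Proof.
move=> [D0 cD0 dD0] r0 disj.
have /choice[phi Hphi] : forall x, exists y, S x -> D0 y /\ ball x (r x) y.
  move=> x; have [Sx|nSx] := pselect (S x); last by exists x.
  have [||y [By Dy]] := dD0 (ball x (r x)).
  - by exists x; apply/ballP; rewrite mdistxx r0.
  - rewrite openE => y /ballP xy; apply/nbhs_ballP.
    exists (r x - mdist x y) => /=; first by rewrite subr_gt0.
    move=> z /ballP yz; apply/ballP.
    by apply: le_lt_trans (metric_triangle x y z) _; rewrite -ltrBrDl.
  by exists y.
have /countable_injP[e einj] := cD0.
apply/countable_injP; exists (e \o phi) => x y /set_mem Sx /set_mem Sy /= exy.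
have [Dx Bx] := Hphi _ Sx; have [Dy By] := Hphi _ Sy.
have pxy : phi x = phi y by apply: einj; rewrite ?inE.
by apply: disj => //; exists (phi x); split => //; rewrite pxy.
Qed.

End vitali.

Section interval_cover.
Context {R : realType}.

(** Subadditivity of Lebesgue measure. It is applied to the distances of the image of a curve from
    its starting point, to show that images of covering balls have total size at least the
    displacement. *)
Lemma interval_cover_length (I : choiceType) (s : seq I) (m L : I -> R) (del : R) :
  (forall i, i \in s -> 0 <= L i) ->
  (forall t, 0 <= t <= del -> exists2 i, i \in s & `|m i - t| <= L i) ->
  del <= \sum_(i <- s) 2 * L i.
Proof.
move=> L0 H; have [d0|d0] := leP 0 del; last first.
  by apply: le_trans (ltW d0) _; rewrite big_seq sumr_ge0// => i /L0 Li; rewrite mulr_ge0.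
pose J i : set R := `[m i - L i, m i + L i]%classic.
have mJ i : measurable (J i) by exact: measurable_itv.
have key s' : {subset s' <= s} -> (lebesgue_measure (\big[setU/set0]_(i <- s') J i) <=
    (\sum_(i <- s') 2 * L i)%:E)%E.
  elim: s' => [|i s' ih] ss'; first by rewrite !big_nil measure0.
  rewrite !big_cons EFinD; apply: le_trans.
    apply: measureU2; first exact: mJ.
    by apply: bigsetU_measurable => j _; exact: mJ.
  apply: leeD; last by apply: ih => j js'; apply: ss'; rewrite inE js' orbT.
  have := L0 i (ss' _ (mem_head _ _)) => Li.
  have := lebesgue_measure_itv `[m i - L i, m i + L i] => /= mJi.
  rewrite [leLHS]mJi lte_fin; case: ltP => _; last by rewrite lee_fin mulr_ge0.
  by rewrite -EFinB lee_fin; lra.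
have cov : `[0, del]%classic `<=` \big[setU/set0]_(i <- s) J i.
  move=> t; rewrite /= in_itv/= => /H[i si hi]; rewrite -bigcup_seq.
  exists i => //; rewrite /J /= in_itv/=.
  by move: hi; rewrite ler_norml => /andP[h1 h2]; apply/andP; split; lra.
have := le_measure lebesgue_measure _ _ cov; rewrite !inE => /(_ (measurable_itv _)).
move=> /(_ (bigsetU_measurable _ (fun i _ => mJ i))) h.
have {h} := le_trans h (key s (fun i => id)).
have := lebesgue_measure_itv `[0, del] => /= ->.
move: d0; rewrite le_eqVlt lte_fin => /predU1P[<-|->].
  by rewrite ltxx lee_fin.
by rewrite sube0 lee_fin.
Qed.

End interval_cover.

(** * Metrically quasiconformal maps *)

Section growth.
Context {R : realType}.

(* If the first alternative failed at all small scales, [L] would decay at least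
   like [48^-k] at the scales [24^-k], hence would be [o(r)]. *)
Lemma growth_dichotomy (L : R -> R) (eps eta : R) : 0 < eps -> 0 < eta ->
  exists r, 0 < r < eta /\ (L (24 * r) <= 48 * L r \/ L (24 * r) <= eps * r).
Proof.
move=> eps0 eta0; apply: contrapT => H.
have {}H r : 0 < r -> r < eta -> 48 * L r < L (24 * r) /\ eps * r < L (24 * r).
  move=> r0 reta; split; rewrite ltNge; apply/negP => h; apply: H; exists r.
    by rewrite r0 reta; split => //; left.
  by rewrite r0 reta; split => //; right.
pose r k : R := eta / 48 / 24 ^+ k.
have r0 k : 0 < r k by rewrite !divr_gt0// exprn_gt0.
have rS k : 24 * r k.+1 = r k.
  by rewrite /r exprS invfM mulrCA; congr (_ * _); rewrite mulrA divff ?mul1r.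
have reta k : r k < eta.
  apply: (@le_lt_trans _ _ (eta / 48)); last by lra.
  rewrite /r ler_pdivrMr ?exprn_gt0// ler_peMr ?exprn_ege1//; lra.
have bound k : L (24 * r k) * 48 ^+ k <= L (24 * r 0).
  elim: k => [|k ih]; first by rewrite expr0 mulr1.
  apply: le_trans ih; rewrite rS exprSr mulrA mulrAC ler_wpM2r ?exprn_ge0//.
  by have [+ _] := H _ (r0 k) (reta k); rewrite mulrC => /ltW.
have key k : eps * (eta / 48) * 2 ^+ k <= L (24 * r 0).
  apply: le_trans (bound k); have [_ h] := H _ (r0 k) (reta k).
  have -> : eps * (eta / 48) * 2 ^+ k = eps * r k * 48 ^+ k.
    rewrite /r (_ : 48 ^+ k = 2 ^+ k * 24 ^+ k); last by rewrite -exprMn; congr (_ ^+ _); ring.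
    have : 24 ^+ k != 0 :> R by rewrite expf_neq0.
    by move=> ?; field.
  by rewrite ler_wpM2r ?exprn_ge0// ltW.
have A0 : 0 < eps * (eta / 48) by rewrite mulr_gt0// divr_gt0.
pose n := (Num.truncn (L (24 * r 0) / (eps * (eta / 48)))).+1.
have h1 : L (24 * r 0) / (eps * (eta / 48)) < n%:R by exact: truncnS_gt.
have h2 := key n.
have h3 : n%:R <= 2 ^+ n :> R by rewrite -natrX ler_nat ltnW// ltn_expl.
move: h1; rewrite ltr_pdivrMr// => h1.
have : L (24 * r 0) < L (24 * r 0).
  apply: lt_le_trans h1 _; apply: le_trans h2; rewrite mulrC ler_wpM2l//; exact: ltW.
by rewrite ltxx.
Qed.

End growth.

Section metric_qc.
Context {R : realType} {d d' : measure_display}.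
Context {X : borelMetricType R d} {Y : borelMetricType R d'}.
Variables (V : set X) (f : X -> Y).

(* Free of quotients: the cases of a vanishing or infinite denominator in
   [metric_quasiconformal] are harmless. *)
Lemma metric_quasiconformal_pointwise : metric_quasiconformal V f ->
  exists2 H : R, 1 <= H & forall x, V x -> exists2 r0 : R, 0 < r0 &
    forall (r : R) y z, 0 < r -> r < r0 -> V y -> V z -> mdist x y <= r ->
      r <= mdist x z -> mdist (f x) (f y) <= H * mdist (f x) (f z).
Proof.
(* The increase by 1 makes the inequality strict, so that the infimum defining the upper limit
   yields an actual neighbourhood of 0. *)
move=> [H H1 qc]; exists (H + 1); first lra.
move=> x Vx.
have : (limf_esup (fun r : R =>
      ereal_sup [set (mdist (f x) (f y))%:E
                | y in [set y | V y /\ (mdist x y <= r)%R]] /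
      ereal_inf [set (mdist (f x) (f y))%:E
                | y in [set y | V y /\ (r <= mdist x y)%R]]) 0%R^'+ < (H + 1)%:E)%E.
  by apply: le_lt_trans (qc x Vx) _; rewrite lte_fin; lra.
rewrite limf_esupE => /ereal_inf_lt[_ [W W0 <-] supW].
move: W0 => /nbhs_ballP[r0 /= r00 Wr]; exists r0 => // r y z r_gt rr0 Vy Vz xy xz.
have Wr' : W r by apply: Wr => //; rewrite /ball/= sub0r normrN gtr0_norm.
set S := ereal_sup _ in supW.
have hr := ereal_sup_ubound (ltac:(by exists r) :
  ((fun r : R =>
      ereal_sup [set (mdist (f x) (f y))%:E
                | y in [set y | V y /\ (mdist x y <= r)%R]] /
      ereal_inf [set (mdist (f x) (f y))%:E
                | y in [set y | V y /\ (r <= mdist x y)%R]])%E @` W) _).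
have {hr supW S} := le_lt_trans hr supW.
set L := ereal_sup _; set l := ereal_inf _ => Ll.
have hL : ((mdist (f x) (f y))%:E <= L)%E by apply: ereal_sup_ubound; exists y.
have hl : (l <= (mdist (f x) (f z))%:E)%E by apply: ereal_inf_lbound; exists z.
have l0 : (0 <= l)%E.
  by apply: le_ereal_inf_tmp => _ [w _ <-]; rewrite lee_fin mdist_ge0.
have L0 : (0 <= L)%E by apply: le_trans hL; rewrite lee_fin mdist_ge0.
case: l => [l| |] in Ll hl l0 *; last 2 first.
- by move: hl; rewrite leye_eq.
- by move: l0; rewrite leeNy_eq.
move: l0; rewrite lee_fin le_eqVlt => /predU1P[l0|l0].
  (* The inverse of 0 is [+oo]: a positive numerator would contradict the finite bound, and a zero
     numerator gives the claim. *)
  move: Ll; rewrite -l0 inver eqxx.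
  move: L0; rewrite le_eqVlt => /predU1P[L0 _|L0].
    move: hL; rewrite -L0 lee_fin => h; apply: le_trans h _.
    by rewrite mulr_ge0 ?mdist_ge0//; lra.
  by rewrite gt0_muley// ltNge leey.
move: Ll; rewrite inver gt_eqF//.
case: L => [L| |] in hL L0 *; last 2 first.
- by rewrite gt0_mulye ?lte_fin ?invr_gt0// ltNge leey.
- by move: hL; rewrite leeNy_eq.
rewrite -EFinM lte_fin ltr_pdivrMr// => h.
move: hL hl; rewrite !lee_fin => hL hl; apply: le_trans hL _.
by apply: le_trans (ltW h) _; rewrite ler_wpM2l//; lra.
Qed.

(* At the scales where the growth of [f] around [x] is controlled, the image of
   the ball contains a ball of comparable size, whose mass controls [Lam `^ Q];
   otherwise [f] is infinitesimally constant at [x]. *)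
Lemma metric_qc_scale (Q : R) (nu : {measure set Y -> \bar R}) (x : X)
    (H c r0 s0 : R) : 0 < Q ->
  open V -> V x ->
  (forall e : R, 0 < e -> exists2 del : R, 0 < del &
    forall z, mdist x z < del -> mdist (f x) (f z) < e) ->
  (exists2 s1 : R, 0 < s1 & ball (f x) s1 `<=` f @` V) ->
  0 < c -> 0 < s0 ->
  (forall s : R, 0 < s -> s <= s0 -> ((c * s `^ Q)%:E <= nu (ball (f x) s))%E) ->
  1 <= H -> 0 < r0 ->
  (forall (r : R) y z, 0 < r -> r < r0 -> V y -> V z -> mdist x y <= r ->
      r <= mdist x z -> mdist (f x) (f y) <= H * mdist (f x) (f z)) ->
  forall eps eta, 0 < eps -> 0 < eta -> exists r Lam s,
    [/\ 0 < r < eta, 0 <= Lam <= eta,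
      forall z, mdist x z < 24 * r -> mdist (f x) (f z) <= Lam &
      Lam <= eps * r \/ [/\ 0 < s, ball (f x) s `<=` f @` (ball x r) &
       ((Lam `^ Q)%:E <= ((48 * H) `^ Q / c)%:E * nu (ball (f x) s))%E]].
Proof.
move=> Q0 oV Vx fc [s1 s10 hs1] c0 s00 mass H1 r00 qc eps eta eps0 eta0.
have [dV dV0 hV] : exists2 del : R, 0 < del & forall z, mdist x z < del -> V z.
  have : nbhs x V by apply: open_nbhs_nbhs.
  by move=> /nbhs_ballP[e /= e0 he]; exists e => // z xz; apply: he; apply/ballP.
pose e := Num.min eta (Num.min s1 s0).
have e0 : 0 < e by rewrite !lt_min eta0 s10.
have [e_eta e_s1 e_s0] : [/\ e <= eta, e <= s1 & e <= s0].
  by rewrite /e !ge_min !lexx ?orbT.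
have [dc dc0 hc] := fc _ e0.
(* For [r < eta'], the ball of radius [24 * r] lies in [V], its image stays within [e] of [f x], and
   the quasiconformality inequality holds at scale [r]. *)
pose eta' := Num.min eta (Num.min (dV / 24) (Num.min (dc / 24) r0)).
have eta'0 : 0 < eta' by rewrite !lt_min eta0 r00 !divr_gt0.
have [e'a e'b e'c e'd] : [/\ eta' <= eta, eta' <= dV / 24, eta' <= dc / 24 & eta' <= r0].
  by rewrite /eta' !ge_min !lexx ?orbT.
pose A r := [set mdist (f x) (f z) | z in [set z | mdist x z < r]].
pose L r := sup (A r).
have hasA r : 0 < r -> r <= dc -> has_sup (A r).
  move=> r_0 rdc; split; first by exists (mdist (f x) (f x)), x => //=; rewrite mdistxx.
  by exists e => _ [z /= xz <-]; apply: ltW; apply: hc; lra.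
have LA r z : 0 < r -> r <= dc -> mdist x z < r -> mdist (f x) (f z) <= L r.
  by move=> r_0 rdc xz; apply: sup_upper_bound; [exact: hasA|exists z].
have Le r : 0 < r -> r <= dc -> L r <= e.
  move=> r_0 rdc; apply: ge_sup; first by case: (hasA _ r_0 rdc).
  by move=> _ [z /= xz <-]; apply: ltW; apply: hc; lra.
have L0 r : 0 < r -> r <= dc -> 0 <= L r.
  by move=> r_0 rdc; rewrite -(mdistxx (f x)); apply: LA => //; rewrite mdistxx.
have [r [/andP[r_0 reta'] hr]] := growth_dichotomy L eps0 eta'0.
have r24 : 0 < 24 * r by rewrite mulr_gt0.
have r24c : 24 * r <= dc by lra.
have rc : r <= dc by lra.
exists r, (L (24 * r)).
have base s : (L (24 * r) <= eps * r \/ [/\ 0 < s, ball (f x) s `<=` f @` (ball x r) &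
       (((L (24 * r)) `^ Q)%:E <= ((48 * H) `^ Q / c)%:E * nu (ball (f x) s))%E]) ->
   [/\ 0 < r < eta, 0 <= L (24 * r) <= eta,
      forall z, mdist x z < 24 * r -> mdist (f x) (f z) <= L (24 * r) &
      L (24 * r) <= eps * r \/ [/\ 0 < s, ball (f x) s `<=` f @` (ball x r) &
       (((L (24 * r)) `^ Q)%:E <= ((48 * H) `^ Q / c)%:E * nu (ball (f x) s))%E]].
  move=> h; split => //.
  - by rewrite r_0; lra.
  - by rewrite L0//= (le_trans (Le _ r24 r24c)).
  - by move=> z xz; apply: LA.
case: hr => [hr|hr]; last by exists 1; apply: base; left.
have := L0 _ r_0 rc; rewrite le_eqVlt => /predU1P[Lr0|Lr0].
  exists 1; apply: base; left; apply: le_trans hr _.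
  by rewrite -Lr0 mulr0 mulr_ge0// ltW.
exists (L r / H); apply: base; right.
have H0 : 0 < H by lra.
have s_0 : 0 < L r / H by rewrite divr_gt0.
have sL : L r / H <= L r by rewrite ler_pdivrMr// ler_peMr// ltW.
have Lre := Le _ r_0 rc.
split => //.
  (* A preimage [z] outside [ball x r] would give [L r <= H * mdist (f x) (f z) < L r]. *)
  move=> w wB; have [z Vz fz] : (f @` V) w.
    apply: hs1; apply/ballP; move/ballP: wB; lra.
  exists z => //; apply/ballP; rewrite ltNge; apply/negP => rz.
  have : L r <= H * mdist (f x) (f z).
    apply: ge_sup; first by case: (hasA _ r_0 rc).
    move=> _ [y /= xy <-]; apply: (qc r) => //; [lra|apply: hV; lra|exact: ltW].
  move/ballP: wB; rewrite -fz ltr_pdivlMr; last lra.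
  by rewrite mulrC => /lt_le_trans h /h; rewrite ltxx.
have m := mass (L r / H) s_0 (ltac:(lra)).
apply: (@le_trans _ _ (((48 * H) `^ Q / c)%:E * (c * (L r / H) `^ Q)%:E)%E); last first.
  by apply: lee_wpmul2l => //; rewrite lee_fin divr_ge0 ?powR_ge0// ltW.
have H48 : 0 <= 48 * H by lra.
rewrite -EFinM lee_fin mulrA divfK ?gt_eqF// -(powRM _ H48 (ltW s_0)).
apply: ge0_ler_powR.
- exact: ltW.
- by rewrite nnegrE L0.
- by rewrite nnegrE mulr_ge0// ltW.
- by rewrite (_ : 48 * H * (L r / H) = 48 * L r)//; field; rewrite gt_eqF.
Qed.

End metric_qc.

Section metric_modulus.
Context {R : realType} {d d' : measure_display}.
Context {X : borelMetricType R d} {Y : borelMetricType R d'}.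
Variables (Q : R) (mu : {measure set X -> \bar R}) (nu : {measure set Y -> \bar R}).
Variables (D : set X) (f : X -> Y) (eps del C M : R).
Hypothesis Q0 : 0 < Q.
Hypothesis sepX : separable_space X.
Hypothesis oD : open D.
Hypothesis ofD : open (f @` D).
Hypothesis injf : forall x y, D x -> D y -> f x = f y -> x = y.
Hypothesis fc : forall x, D x -> forall e : R, 0 < e -> exists2 de : R, 0 < de &
    forall z, mdist x z < de -> mdist (f x) (f z) < e.
Hypothesis eps0 : 0 < eps.
Hypothesis del0 : 0 < del.
Hypothesis C0 : 0 <= C.
Hypothesis M0 : 0 <= M.

(* [24] comes from two successive applications of the covering lemma: the balls
   of radii [3 * r] cover [D], and those of radii [24 * r] still cover a compact
   curve after passing to a subfamily with disjoint balls of radii [6 * r]. *)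
Definition good_scale (x : X) (w : R * R * R) :=
  let: (r, Lam, s) := w in
  [/\ 0 < r <= 1 /\ ball x (24 * r) `<=` D,
      (mu (ball x (6 * r)) <= (C * (6 * r) `^ Q)%:E)%E,
      0 <= Lam /\ 2 * Lam < del,
      forall z, mdist x z < 24 * r -> mdist (f x) (f z) <= Lam &
      Lam <= eps * r \/ [/\ 0 < s, ball (f x) s `<=` f @` (ball x r) &
       ((Lam `^ Q)%:E <= M%:E * nu (ball (f x) s))%E]].

Hypothesis scales : forall x, D x -> exists w, good_scale x w.

(* The density is the [kk x = 2 Lam x / (3 r x del)] on the balls of radii [6 * r x]
   with a large [Lam x], and the constant [2 eps / (3 del)] elsewhere. A curve
   crosses the shells [3 r < |. - x| < 6 r] of the balls that cover it, where it
   collects [2 Lam x / del]; the sum of the [2 Lam x] is at least the diameter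
   [del] of its image. *)
Lemma metric_modulus_le (Gamma : set (curve R X)) :
  (forall c, Gamma c -> exists a b a' b', [/\ [/\ a <= a', a' <= b' & b' <= b],
     cdom c = `[a, b]%classic, forall t, a' <= t <= b' -> D (c t) &
     del <= mdist (f (c a')) (f (c b'))]) ->
  (modulus Q mu Gamma <= ((2 / 3 * (eps / del)) `^ Q)%:E * mu D +
     (C * (4 / del) `^ Q * M)%:E * nu (f @` D))%E.
Proof.
move=> HG.
have /choice[w Hw] : forall x, exists w, D x -> good_scale x w.
  move=> x; have [/scales[w]|nD] := pselect (D x); first by exists w.
  by exists (0, 0, 0).
pose r x := (w x).1.1; pose Lam x := (w x).1.2; pose s x := (w x).2.
have {}Hw x : D x -> good_scale x (r x, Lam x, s x).
  by move=> /Hw; rewrite /r /Lam /s; case: (w x) => [[]].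
have r0 x : D x -> 0 < r x <= 1 by move=> /Hw[[]].
have Lam0 x : D x -> 0 <= Lam x by move=> /Hw[_ _ []].
have [S [SD Sdisj Scov]] := vitali_covering r0.
have cS : countable S.
  by apply: (disjoint_balls_countable sepX _ Sdisj) => x /SD/r0/andP[].
have /countable_injP[e einj] := cS.
have {}einj x y : S x -> S y -> e x = e y -> x = y.
  by move=> Sx Sy; apply: einj; exact: mem_set.
(* The inverse of the enumeration [e] of [S]; it is partial since [S] may be finite or empty. *)
have /choice[g Hg] : forall n, exists o : option X,
    (forall x, o = Some x <-> S x /\ e x = n).
  move=> n; have [[x [Sx xn]]|nx] := pselect (exists x, S x /\ e x = n).
    exists (Some x) => y; split => [[<-]//|[Sy yn]].
    by congr Some; apply: einj => //; rewrite xn.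
  by exists None => x; split => // h; exfalso; apply: nx; exists x.
pose kk x := 2 / 3 * (Lam x / (r x * del)).
pose good x := ~ (Lam x <= eps * r x).
(* Index 0 carries the constant density on [D]; the later indices carry the balls around the points
   of [S] with large [Lam]. The sets [F] are the corresponding round balls in the image. *)
pose B n : set X := if n is m.+1 then
  (if g m is Some x then [set z | good x /\ ball x (6 * r x) z] else set0) else D.
pose c n : R := if n is m.+1 then
  (if g m is Some x then kk x else 0) else 2 / 3 * (eps / del).
pose F n : set Y := if n is m.+1 then
  (if g m is Some x then [set z | good x /\ ball (f x) (s x) z] else set0) else set0.
have kk0 x : D x -> 0 <= kk x.
  move=> Dx; rewrite mulr_ge0// ?divr_ge0 ?Lam0//.
  by apply: mulr_ge0; apply: ltW => //; case/andP: (r0 _ Dx).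
have c0 n : 0 <= c n.
  case: n => [|n] /=; first by rewrite mulr_ge0// ?divr_ge0// ltW.
  by case E : (g n) => [x|//]; apply: kk0; apply: SD; have [/(_ E)[]] := Hg n x.
have mset (T : Type) (P : Prop) (A : set T) : P -> [set z | P /\ A z] = A.
  by move=> p; apply/seteqP; split => z; [case|].
have mset0 (T : Type) (P : Prop) (A : set T) : ~ P -> [set z | P /\ A z] = set0.
  by move=> np; apply/seteqP; split => z //; case.
have mB n : measurable (B n).
  case: n => [|n] /=; first exact: open_borel_measurable.
  case: (g n) => [x|//]; have [gx|ngx] := pselect (good x).
    by rewrite mset//; apply: open_borel_measurable; exact: open_ball_metric.
  by rewrite mset0.
have mF n : measurable (F n).
  case: n => [|n] /=; first exact: measurable0.
  case: (g n) => [x|//]; have [gx|ngx] := pselect (good x).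
    by rewrite mset//; apply: open_borel_measurable; exact: open_ball_metric.
  by rewrite mset0.
have [rho [mrho rho0 rhoc intrho]] := exists_power_density mu Q0 mB c0.
apply: (@le_trans _ _ (\int[mu]_x (rho x `^ Q))%E).
  apply: modulus_le_integral; split => // ga Gga lr.
  have [a [b [a' [b' [[aa' ab' bb'] domg gD gdel]]]]] := HG _ Gga.
  have ab : a <= b by rewrite (le_trans aa')// (le_trans ab').
  have gc : {within `[a, b], continuous ga}.
    by have := @cmap_continuous _ _ ga; rewrite domg.
  have gc' : {within `[a', b'], continuous ga} by exact: within_continuous_sub gc.
  pose K := ga @` `[a', b'].
  have cK : compact K.
    by apply: continuous_compact => //; exact: segment_compact.
  have KD : K `<=` D by move=> _ [t + <-]; rewrite /= in_itv/= => /gD.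
  have covK : K `<=` cover S (fun y => ball y (3 * r y)).
    move=> z /KD Dz; have [y Sy [[u [/ballP zu /ballP yu]] rzy]] := Scov _ Dz.
    exists y => //; apply/ballP; have := metric_triangle y u z.
    rewrite (metric_sym u z); lra.
  have [J0 J0S covJ0] : finite_subset_cover S (fun y => ball y (3 * r y)) K.
    move: cK; rewrite compact_cover; apply => // y _; exact: open_ball_metric.
  pose D1 := [set y | y \in J0 /\ (ball y (3 * r y) `&` K) !=set0].
  have D1S : D1 `<=` S by move=> y [/J0S/set_mem].
  (* Balls of [S] may overlap once enlarged sixfold; this second selection makes the shells
     disjoint. *)
  have [S1 [S1D1 S1disj S1cov]] := @vitali_covering _ X D1 (fun y => 6 * r y) 6
    (fun y Dy => ltac:(by have := r0 _ (SD _ (D1S _ Dy)); lra)).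
  pose s1 := [seq y <- enum_fset J0 | `[< S1 y >]].
  have s1P y : y \in s1 <-> S1 y.
    rewrite mem_filter; split => [/andP[/asboolP]//|S1y].
    by apply/andP; split; [exact/asboolP|have [] := S1D1 _ S1y].
  have s1D y : y \in s1 -> [/\ S1 y, S y, D y & D1 y].
    by move=> /s1P S1y; split => //; [apply: D1S|apply/SD/D1S|]; exact: S1D1.
  apply: le_trans (@shells_line_integral _ _ rho ga a b X s1 id
    (fun y => 3 * r y) (fun y => 6 * r y) kk rho0 ab domg lr _ _ _ _ _ _).
  - rewrite lee_fin (eq_big_seq (fun y => (2 * Lam y) / del)); last first.
      move=> y /s1D[_ _ Dy _]; rewrite /kk; have /andP[ry _] := r0 _ Dy.
      by field; rewrite !gt_eqF.
    rewrite -mulr_suml ler_pdivlMr// mul1r.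
    apply: (@interval_cover_length _ _ _ (fun y => mdist (f y) (f (ga a')))).
      by move=> y /s1D[_ _ Dy _]; exact: Lam0.
    move=> t /andP[t0 tdel].
    have hcont : {within `[a', b'], continuous (fun u => mdist (f (ga u)) (f (ga a')))}.
      apply: within_continuous_mdist; apply/within_continuous_mdistP => u uab e' e'0.
      have [|de de0 Hde] := fc (x := ga u) _ e'0; first by apply: gD; move: uab; rewrite /= in_itv.
      have [de' de'0 Hde'] := (within_continuous_mdistP _ _).1 gc' u uab _ de0.
      by exists de' => // u' u'ab uu'; apply: Hde; exact: Hde'.
    have [|u] := @IVT R _ a' b' t ab' hcont.
      rewrite mdistxx min_l ?mdist_ge0// max_r ?mdist_ge0// t0/=.
      by rewrite metric_sym (le_trans tdel).
    rewrite in_itv/= => uab hu.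
    have Kgu : K (ga u) by exists u => //=; rewrite in_itv.
    have [y0 /= J0y0 By0] := covJ0 _ Kgu.
    have D1y0 : D1 y0 by split => //; exists (ga u).
    have [y S1y [[v [/ballP y0v /ballP yv]] ry]] := S1cov _ D1y0.
    have Dy : D y by apply/SD/D1S/S1D1.
    exists y; first exact/s1P.
    have [_ _ _ Hz _] := Hw _ Dy.
    rewrite -hu; apply: le_trans (mdist_triangle_abs _ _ _) _; apply: Hz.
    move/ballP: By0 => By0.
    (* As [r y0 <= 2 * r y], the distance is less than [6 * r y + 6 * r y0 + 3 * r y0 <= 24 * r
       y]. *)
    have := metric_triangle y v (ga u); have := metric_triangle v y0 (ga u).
    rewrite (metric_sym v y0); lra.
  - by rewrite filter_uniq// fset_uniq.
  - move=> y /s1D[_ _ Dy _]; split; first exact: kk0.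
    have /andP[ry _] := r0 _ Dy; lra.
  - move=> y /s1D[_ _ _ [_ [z [/ballP yz [t + tz]]]]]; rewrite /= in_itv/= => tab.
    by exists t; [lra|rewrite tz metric_sym ltW].
  (* If the curve stayed in the ball of radius [6 * r y], the images of its times [a'] and [b']
     would be within [2 * Lam y < del]. *)
  - move=> y /s1D[_ _ Dy _]; apply: contrapT => nq.
    have near_y t : a' <= t <= b' -> mdist (f y) (f (ga t)) <= Lam y.
      move=> tab; have [_ _ _ Hz _] := Hw _ Dy; apply: Hz.
      have /andP[ry _] := r0 _ Dy.
      apply: (@lt_trans _ _ (6 * r y)); last lra.
      rewrite ltNge; apply/negP => h; apply: nq; exists t; first lra.
      by rewrite metric_sym.
    have h1 := near_y a' (ltac:(lra)); have h2 := near_y b' (ltac:(lra)).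
    have [_ _ [_ h3] _ _] := Hw _ Dy.
    have := metric_triangle (f (ga a')) (f y) (f (ga b')).
    rewrite (metric_sym _ (f y)); lra.
  - move=> y t /s1D[_ Sy Dy _] tab /andP[h1 h2].
    have byt : ball y (6 * r y) (ga t) by apply/ballP; rewrite metric_sym.
    have /andP[ry _] := r0 _ Dy.
    have gy : g (e y) = Some y by apply/Hg.
    have [gd|/contrapT bad] := pselect (good y).
      have := rhoc (e y).+1 (ga t); rewrite /B /c gy; apply; by split.
    (* When [Lam y <= eps * r y], the value [kk y] is at most the constant density of index 0. *)
    apply: le_trans (rhoc 0 (ga t) _); last first.
      have [[_ bD] _ _ _ _] := Hw _ Dy; apply: bD; apply/ballP; rewrite metric_sym; lra.
    rewrite lee_fin /c /kk ler_wpM2l//.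
    rewrite invfM mulrA; apply: ler_wpM2r; first by rewrite invr_ge0 ltW.
    by rewrite ler_pdivrMr.
  - move=> x y z /s1D[S1x _ _ _] /s1D[S1y _ _ _] /andP[_ hx] /andP[_ hy].
    apply: S1disj => //; exists z; split; apply/ballP; by rewrite metric_sym.
rewrite intrho nneseries_recl//; last first.
  by move=> k _; rewrite mule_ge0// lee_fin powR_ge0.
rewrite leeD2l//.
have K0 : 0 <= C * (4 / del) `^ Q * M by rewrite !mulr_ge0// powR_ge0.
(* Each [F] is contained in the image of a ball of [S]; those balls are disjoint and [f] is
   injective. *)
have trivF : trivIset setT F.
  move=> i j _ _ [z [Fi Fj]].
  case: i Fi => [//|i]; case: j Fj => [//|j] /=.
  case Ei : (g i) => [x|//]; case Ej : (g j) => [y|//].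
  have [/(_ Ei)[Sx exi] _] := Hg i x; have [/(_ Ej)[Sy eyj] _] := Hg j y.
  move=> [gy hy] [gx hx].
  have [[/andP[rx rx1] bxD] _ _ _ [//|[_ hx' _]]] := Hw _ (SD _ Sx).
  have [[/andP[ry ry1] byD] _ _ _ [//|[_ hy' _]]] := Hw _ (SD _ Sy).
  have [u /ballP xu fu] := hx' _ hx; have [v /ballP yv fv] := hy' _ hy.
  have uv : u = v.
    by apply: injf; [apply/bxD/ballP; lra|apply/byD/ballP; lra|rewrite fu fv].
  have xy : x = y by apply: Sdisj => //; exists u; split; apply/ballP; rewrite // uv.
  by rewrite -exi -eyj xy.
apply: (@le_trans _ _ (\sum_(1 <= k <oo) ((C * (4 / del) `^ Q * M)%:E * nu (F k)))%E).
  rewrite [leLHS]eseries_cond [leRHS]eseries_cond.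
  apply: lee_nneseries.
    by move=> k _ _; rewrite mule_ge0// lee_fin powR_ge0.
  move=> [//|n] _ /=.
  case En : (g n) => [x|]; last by rewrite !measure0 !mule0.
  have [gx|ngx] := pselect (good x); last by rewrite !mset0// !measure0 !mule0.
  rewrite !mset//.
  have [/(_ En)[Sx _] _] := Hg n x.
  have [[/andP[rx _] _] mux [Lx _] _ [//|[_ _ Lnu]]] := Hw _ (SD _ Sx).
  apply: (@le_trans _ _ ((kk x `^ Q)%:E * (C * (6 * r x) `^ Q)%:E)%E).
    by apply: lee_wpmul2l => //; rewrite lee_fin powR_ge0.
  rewrite -EFinM mulrCA -powRM; [|exact: kk0 (SD _ Sx)|lra].
  (* The radius cancels, so the cost of a ball is a multiple of [Lam x] to the power [Q], which the
     measure of its round image controls. *)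
  have -> : kk x * (6 * r x) = 4 / del * Lam x.
    by rewrite /kk; field; rewrite !gt_eqF.
  rewrite powRM//; last by rewrite divr_ge0// ltW.
  rewrite mulrA EFinM [X in (_ <= X * _)%E]EFinM -muleA.
  by apply: lee_wpmul2l => //; rewrite lee_fin mulr_ge0// powR_ge0.
apply: (@le_trans _ _ (\sum_(0 <= k <oo) ((C * (4 / del) `^ Q * M)%:E * nu (F k)))%E).
  rewrite [leRHS]nneseries_recl//; last by move=> k _; rewrite mule_ge0.
  by rewrite measure0 mule0 add0e.
rewrite nneseriesZl//; apply: lee_wpmul2l; first by rewrite lee_fin.
rewrite -measure_semi_bigcup//; last exact: bigcup_measurable.
apply: le_measure.
- by apply: mem_set; exact: bigcup_measurable.
- by apply: mem_set; exact: open_borel_measurable.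
- move=> z [[//|n] _] /=; case En : (g n) => [x|//] [gx hx].
  have [/(_ En)[Sx _] _] := Hg n x.
  have [[/andP[rx _] bD] _ _ _ [//|[_ hx' _]]] := Hw _ (SD _ Sx).
  have [u /ballP xu <-] := hx' _ hx; exists u => //; apply/bD/ballP; lra.
Qed.

End metric_modulus.

(** * The punctured ball *)

Section bounded_geometry.
Context {R : realType} {d : measure_display} {X : borelMetricType R d}.

Lemma bounded_geometry_local (Q : R) (mu : {measure set X -> \bar R}) :
  locally_bounded_geometry Q mu -> exists (C lam : R) (psi : R -> R),
  [/\ 1 <= C, 0 < lam <= 1, forall t, 0 < t -> 0 < psi t &
    forall z, exists2 r0 : R, 0 < r0 & forall r : R, 0 < r -> r <= r0 ->
      (mu (ball z r) <= (C * r `^ Q)%:E)%E /\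
      loewner_bound Q mu psi (ball z (lam * r)) (ball z r)].
Proof.
move=> [_ _ _ [C [lam [psi [C1 lam01 [psi0 _] HW]]]]].
exists C, lam, psi; split => // z.
have [W [/nbhs_ballP[r0 /= r00 zW] _ mass low]] := HW z.
exists r0 => // r r_0 rr0.
have zrW : ball z r `<=` W by apply: subset_trans zW; exact: le_ball.
by split; [exact: mass|exact: low].
Qed.

End bounded_geometry.

Section homeomorphisms.
Context {R : realType}.

Lemma open_setP (X : metricType R) (A : set X) : open A <->
  forall x, A x -> exists2 e : R, 0 < e & forall y, mdist x y < e -> A y.
Proof.
rewrite openE; split => H x /H.
  by move=> /nbhs_ballP[e /= e0 he]; exists e => // y xy; apply/he/ballP.
move=> [e e0 he]; apply/nbhs_ballP; exists e => // y /ballP; exact: he.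
Qed.

Lemma open_within_continuous_mdistP (X Y : metricType R) (V : set X)
    (f : X -> Y) : open V -> {within V, continuous f} ->
  forall x, V x -> forall e : R, 0 < e ->
  exists2 del : R, 0 < del & forall z, mdist x z < del -> mdist (f x) (f z) < e.
Proof.
move=> oV /subspace_continuousP fc x Vx e e0.
have /metricType_numDomainType.cvgrPdist_lt/(_ e e0) := fc x Vx.
rewrite near_withinE => /nbhs_ballP[del /= del0 H].
have [dV dV0 hV] := (open_setP V).1 oV x Vx.
exists (Num.min del dV); first by rewrite lt_min del0.
move=> z; rewrite lt_min => /andP[h1 h2].
by apply: H; [apply/ballP|exact: hV].
Qed.

Lemma homeomorphism_on_openP (X Y : metricType R) (V : set X) (f : X -> Y) :
  open V -> open (f @` V) ->
  homeomorphism_on V (f @` V) f ->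
  [/\ forall x y, V x -> V y -> f x = f y -> x = y,
    forall x, V x -> forall e : R, 0 < e ->
      exists2 del : R, 0 < del & forall z, mdist x z < del -> mdist (f x) (f z) < e,
    forall A, A `<=` V -> open A -> open (f @` A) &
    exists2 g : Y -> X, forall x, V x -> g (f x) = x &
      forall y, (f @` V) y -> forall e : R, 0 < e ->
      exists2 del : R, 0 < del & forall z, mdist y z < del -> mdist (g y) (g z) < e].
Proof.
move=> oV ofV [[_ finj _] fc [g gf gc]].
have gfV x : V x -> g (f x) = x by move=> Vx; apply: gf; exact: mem_set.
have gc' := open_within_continuous_mdistP ofV gc.
split.
- by move=> x y Vx Vy; apply: finj; exact: mem_set.
- exact: open_within_continuous_mdistP.
- move=> A AV oA; apply/open_setP => _ [x Ax <-].
  have [e e0 he] := (open_setP A).1 oA x Ax.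
  have fx : (f @` V) (f x) by exists x => //; exact: AV.
  have [d1 d10 h1] := gc' _ fx _ e0.
  have [d2 d20 h2] := (open_setP _).1 ofV _ fx.
  exists (Num.min d1 d2); first by rewrite lt_min d10.
  move=> y; rewrite lt_min => /andP[y1 y2].
  have [z Vz zy] := h2 _ y2; exists z => //; apply: he.
  by rewrite -(gfV z Vz) -(gfV x (AV _ Ax)) zy; exact: h1.
- by exists g.
Qed.

End homeomorphisms.

Section puncture.
Context {R : realType} {X Y : metricType R}.
Variables (V : set X) (x0 : X) (f : X -> Y) (g : Y -> X) (r : R).
Hypothesis cB : compact (closure (ball x0 r)).
Hypothesis BV : closure (ball x0 r) `\ x0 `<=` V.
Hypothesis fc : forall x, V x -> forall e : R, 0 < e ->
  exists2 del : R, 0 < del & forall z, mdist x z < del -> mdist (f x) (f z) < e.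
Hypothesis fopen : forall A, A `<=` V -> open A -> open (f @` A).
Hypothesis gf : forall x, V x -> g (f x) = x.
Hypothesis gc : forall y, (f @` V) y -> forall e : R, 0 < e ->
  exists2 del : R, 0 < del & forall z, mdist y z < del -> mdist (g y) (g z) < e.

Let G := f @` (ball x0 r `\ x0).

Lemma punctured_ball_sub : ball x0 r `\ x0 `<=` V.
Proof. by move=> x [xB xx0]; apply: BV; split => //; exact: subset_closure. Qed.

Lemma open_punctured_ball (x : X) (s : R) : open (ball x s `\ x).
Proof.
rewrite setDE; apply: openI; first exact: open_ball_metric.
apply: closed_openC.
apply: accessible_closed_set1; apply: hausdorff_accessible.
exact: metric_hausdorff.
Qed.

Lemma open_punctured_image : open G.
Proof. by apply: fopen; [exact: punctured_ball_sub|exact: open_punctured_ball]. Qed.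

(** Only the puncture is lost to compactness. Images of the part at distance at least [s] are
    therefore closed in [Y]. *)
Lemma compact_outer_image (s : R) : 0 < s ->
  compact (f @` (closure (ball x0 r) `&` [set x | s <= mdist x0 x])).
Proof.
move=> s0; apply: continuous_compact; last first.
  apply: compact_closedI => //.
  rewrite (_ : [set x | _] = ~` ball x0 s); last first.
    apply/seteqP; split => x /=.
      by move=> h /ballP; rewrite ltNge h.
    by move=> h; rewrite leNgt; apply/negP => h'; apply/h/ballP.
  by apply: open_closedC; exact: open_ball_metric.
apply/subspace_continuousP => x [clx /= sx].
have Vx : V x by apply: BV; split => // xx0; move: sx; rewrite xx0 mdistxx; lra.
apply/metricType_numDomainType.cvgrPdist_lt => e e0.
have [de de0 H] := fc Vx e0.
rewrite near_withinE; apply/nbhs_ballP; exists de => //= z /ballP xz _.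
exact: H.
Qed.

(* [g \o gam] follows [gam] in the punctured ball until it converges to [x0]. *)
Lemma path_to_puncture (gam : R -> Y) (a b : R) : a <= b ->
  {within `[a, b], continuous gam} -> G (gam a) -> ~ G (gam b) ->
  (forall t, a <= t <= b -> ~ (f @` boundary (ball x0 r)) (gam t)) ->
  exists tau, [/\ a < tau <= b,
    forall t, a <= t < tau -> [/\ ball x0 r (g (gam t)), g (gam t) <> x0 &
      f (g (gam t)) = gam t],
    forall u, a <= u < tau -> {within `[a, u], continuous (g \o gam)} &
    forall eta : R, 0 < eta -> exists2 u, a <= u < tau & mdist (g (gam u)) x0 < eta].
Proof.
move=> ab gamc Ga Gb gamb.
have [tau [atau taub Gtau Gbelow]] := first_exit ab gamc open_punctured_image Ga Gb.
have inG t : a <= t < tau -> [/\ ball x0 r (g (gam t)), g (gam t) <> x0 &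
      f (g (gam t)) = gam t].
  move=> /andP[at_ tt]; have [x [xB xx0] fx] := Gbelow _ at_ tt.
  have Vx : V x by apply: punctured_ball_sub.
  by rewrite -fx gf.
exists tau; split => //.
- by rewrite atau.
- move=> u /andP[au ut]; apply/within_continuous_mdistP => t tu e e0.
  move: (tu); rewrite /= in_itv/= => /andP[at_ tu'].
  have fgam : (f @` V) (gam t).
    have [|xB xx0 fx] := inG t; first lra.
    by exists (g (gam t)) => //; apply: punctured_ball_sub.
  have [d1 d10 h1] := gc fgam e0.
  have gamc' : {within `[a, u], continuous gam}.
    by apply: within_continuous_sub gamc => //; lra.
  have [d2 d20 h2] := (within_continuous_mdistP _ _).1 gamc' t tu _ d10.
  by exists d2 => // t' t'u tt'; apply: h1; exact: h2.
(* If the lifted path stayed at distance at least [eta] from [x0], the exit point would lie in the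
   closed set [K], hence in [G] or in the image of the boundary, both excluded. *)
- move=> eta eta0; apply: contrapT => H.
  pose K := f @` (closure (ball x0 r) `&` [set x | eta <= mdist x0 x]).
  have clK : closed K.
    by apply: compact_closed; [exact: metric_hausdorff|exact: compact_outer_image].
  apply: Gtau.
  have Kt : K (gam tau).
    apply: clK => W /nbhs_ballP[e /= e0 heW].
    have tI : `[a, b]%classic tau by rewrite /= in_itv/= (ltW atau).
    have [de de0 hde] := (within_continuous_mdistP _ _).1 gamc tau tI _ e0.
    pose t := Num.max a (tau - de / 2).
    have [ta tb tc] : [/\ a <= t, t < tau & tau - t < de].
      rewrite /t; split; first by rewrite le_max lexx.
        by rewrite gt_max atau; lra.
      have : tau - de / 2 <= Num.max a (tau - de / 2) by rewrite le_max lexx orbT.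
      lra.
    exists (gam t); split; last first.
      apply: heW; apply/ballP; apply: hde; first by rewrite /= in_itv/=; lra.
      by rewrite ger0_norm; lra.
    have [|xB xx0 fx] := inG t; first lra.
    exists (g (gam t)) => //; split; first exact: subset_closure.
    rewrite /= leNgt; apply/negP => h; apply: H; exists t; first lra.
    by rewrite metric_sym.
  have [x [clx ex] fx] := Kt.
  have xx0 : x <> x0 by move=> xx0; move: ex; rewrite /= xx0 mdistxx; lra.
  exists x => //; split => //.
  apply: contrapT => nB; apply: (gamb tau); first by rewrite (ltW atau).
  exists x => //; split => // /interior_subset; exact: nB.
Qed.

(** A crossing of the shell between the radii [t / 2] and [t]: its diameter is at least the width of
    the shell, hence comparable to [t]. *)
Lemma tail_continuum (h : R -> X) (a tau t : R) : 0 < t -> t <= mdist (h a) x0 ->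
  (forall u, a <= u < tau -> {within `[a, u], continuous h}) ->
  (forall eta : R, 0 < eta -> exists2 u, a <= u < tau & mdist (h u) x0 < eta) ->
  exists E : set X, [/\ continuum E, E `<=` h @` `[a, tau[,
    forall z, E z -> t / 2 <= mdist z x0 <= t &
    exists e1 e2, [/\ E e1, E e2 & t / 2 <= mdist e1 e2]].
Proof.
move=> t0 tha hc hlim.
have t20 : 0 < t / 2 by rewrite divr_gt0.
have [u /andP[au utau] hu] := hlim _ t20.
have hcu : {within `[a, u], continuous h} by apply: hc; rewrite au.
have uI : a <= u <= u by rewrite au lexx.
have aI : a <= a <= u by rewrite au lexx.
have t2t : t / 2 < t by lra.
have [p [q [ap pq qu hpq H]]] := @crossing _ (fun t => mdist (h t) x0) a u u a (t / 2) t
  (within_continuous_mdist hcu) uI aI t2t (ltW hu) tha.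
have hq s : p <= s <= q -> t / 2 <= mdist (h s) x0 <= t.
  move=> /andP[]; rewrite le_eqVlt => /predU1P[<-|ps].
    by move=> _; case: hpq => -[-> _]; lra.
  rewrite le_eqVlt => /predU1P[->|sq]; first by case: hpq => -[_ ->]; lra.
  by have := H _ ps sq; lra.
exists (h @` `[p, q]); split.
- by apply: continuum_path_image; [exact: ltW|apply: within_continuous_sub hcu].
- move=> _ [s + <-]; rewrite /= in_itv/= => hs; exists s => //=; rewrite in_itv/=; lra.
- by move=> _ [s + <-]; rewrite /= in_itv/=; exact: hq.
- exists (h p), (h q); split.
  + by exists p => //=; rewrite in_itv/= lexx ltW.
  + by exists q => //=; rewrite in_itv/= lexx ltW.
  + have := mdist_triangle_abs (h p) (h q) x0.
    case: hpq => -[-> ->]; last by rewrite ger0_norm; lra.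
    by rewrite distrC ger0_norm; lra.
Qed.

End puncture.

(** * Curves whose images leave the neighbourhood of a point *)

Section escaping_curves.
Context {R : realType} {d d' : measure_display}.
Context {X : borelMetricType R d} {Y : borelMetricType R d'}.
Variables (Q : R) (mu : {measure set X -> \bar R}) (nu : {measure set Y -> \bar R}).
Variables (V : set X) (f : X -> Y) (g : Y -> X) (x0 : X) (y1 : Y) (de : R).
Hypothesis Q0 : 0 < Q.
Hypothesis oV : open V.
Hypothesis ofV : open (f @` V).
Hypothesis injf : forall x y, V x -> V y -> f x = f y -> x = y.
Hypothesis fc : forall x, V x -> forall e : R, 0 < e ->
  exists2 del : R, 0 < del & forall z, mdist x z < del -> mdist (f x) (f z) < e.
Hypothesis fopen : forall A, A `<=` V -> open A -> open (f @` A).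
Hypothesis de0 : 0 < de.

Definition escaping_curves (D : set X) : set (curve R X) :=
  [set c | curves_in D c /\ exists a b, [/\ a <= b, cdom c = `[a, b]%classic,
     exists2 p, a <= p <= b & mdist (f (c p)) y1 <= de &
     exists2 q, a <= q <= b & 2 * de <= mdist (f (c q)) y1]].

(** By injectivity the images of the punctured balls decrease to the empty set; finiteness of the
    measure of [ball y1 (2 * de)] allows continuity from above. *)
Lemma punctured_image_measure_small (R0 : R) :
  0 < R0 -> ball x0 R0 `\ x0 `<=` V -> (nu (ball y1 (2 * de)) < +oo)%E ->
  forall th : R, 0 < th -> exists2 R1 : R, 0 < R1 <= R0 & forall r : R, 0 < r -> r <= R1 ->
    (nu ((f @` (ball x0 r `\ x0)) `&` ball y1 (2 * de)) <= th%:E)%E.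
Proof.
move=> R00 BV nufin th th0.
pose A r := (f @` (ball x0 r `\ x0)) `&` ball y1 (2 * de).
have mA r : r <= R0 -> measurable (A r).
  move=> rR0; apply: measurableI; apply: open_borel_measurable.
    apply: fopen; last exact: open_punctured_ball.
    by apply: subset_trans BV => x [xB xx0]; split => //; exact: le_ball xB.
  exact: open_ball_metric.
have Amono r s : r <= s -> A r `<=` A s.
  move=> rs y [[x [xB xx0] <-] yB]; split => //; exists x => //; split => //.
  exact: le_ball xB.
pose rad n : R := R0 / n.+1%:R.
have rad0 n : 0 < rad n by rewrite divr_gt0.
have radle n m : (n <= m)%N -> rad m <= rad n.
  by move=> nm; rewrite ler_pM2l// lef_pV2 ?posrE// ler_nat.
have radR0 n : rad n <= R0 by rewrite ler_pdivrMr// ler_peMr ?ler1n// ltW.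
pose F n := A (rad n).
have capF : \bigcap_n F n = set0.
  rewrite -subset0 => y Fy.
  have [[x [xB /= xx0] fx] _] := Fy 0 I.
  have dx : 0 < mdist x0 x by rewrite mdist_gt0; apply/eqP => xe; apply: xx0.
  pose n := Num.truncn (R0 / mdist x0 x).
  have hn : R0 / mdist x0 x < n.+1%:R by exact: truncnS_gt.
  have [[z [/ballP zB /= zx0] fz] _] := Fy n I.
  have zx : z = x.
    apply: injf; last by rewrite fx fz.
      by apply: BV; split => //; apply/ballP; apply: lt_le_trans zB (radR0 n).
    by apply: BV; split => //; apply: le_ball xB.
  move: zB; rewrite zx /rad ltr_pdivlMr// => h.
  move: hn; rewrite ltr_pdivrMr// mulrC => h'.
  by have := lt_trans h h'; rewrite ltxx.
have : (nu \o F) n @[n --> \oo] --> nu (\bigcap_n F n).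
  apply: nonincreasing_cvg_mu.
  - apply: le_lt_trans nufin; apply: le_measure; [| |by move=> y []].
      by apply: mem_set; apply: mA.
    by apply: mem_set; apply: open_borel_measurable; exact: open_ball_metric.
  - by move=> n; apply: mA.
  - by rewrite capF.
  - by move=> n m nm; apply/subsetPset; apply: Amono; exact: radle.
rewrite capF measure0 => /fine_cvgP[] /= finF /cvgrPdist_lt/(_ _ th0) smallF.
have [n [fn sn]] : exists n, nu (F n) \is a fin_num /\ `|0 - fine (nu (F n))| < th.
  have [n _ H] := filterI finF smallF.
  by exists n; have [] := H n (leqnn n).
exists (rad n); first by rewrite rad0 radR0.
move=> r r0 rn; apply: (@le_trans _ _ (nu (F n))).
  apply: le_measure; [| |exact: Amono].
    by apply: mem_set; apply: mA; apply: le_trans rn _.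
  by apply: mem_set; apply: mA.
rewrite -(fineK fn) lee_fin; move: sn; rewrite sub0r normrN => /ltW.
by apply: le_trans; exact: ler_norm.
Qed.

Lemma geometric_escaping_modulus (K : R) (D : set X) : 1 <= K ->
  D `<=` V -> open D ->
  (forall Gamma, Gamma `<=` curves_in V ->
    ((K^-1)%:E * modulus Q mu Gamma <= modulus Q nu (image_curves f Gamma))%E) ->
  (modulus Q mu (escaping_curves D) <=
     (K * (de^-1) `^ Q)%:E * nu ((f @` D) `&` ball y1 (2 * de)))%E.
Proof.
move=> K1 DV oD qc; have K0 : 0 < K by lra.
have sub : escaping_curves D `<=` curves_in V.
  by move=> c [cD _] x /cD; exact: DV.
have {sub}qc := qc _ sub.
have ub : (modulus Q nu (image_curves f (escaping_curves D)) <=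
    ((2 * de - de)^-1 `^ Q)%:E * nu ((f @` D) `&` ball y1 (2 * de)))%E.
  apply: (@modulus_shell_le _ _ _ Q nu _ _ y1) => //.
  - apply: measurableI; apply: open_borel_measurable; first exact: fopen.
    exact: open_ball_metric.
  - by rewrite ltr_pMl// ltr1n.
  - move=> c' [c [cD [a [b [ab domc [p pab hp] [q qab hq]]]]] [domc' c'c]].
    have dom t : a <= t <= b -> cdom c t by rewrite domc /= in_itv.
    exists a, b; split => //; first by rewrite domc'.
    + by exists p => //; rewrite c'c//; exact: dom.
    + by exists q => //; rewrite c'c//; exact: dom.
    + move=> t tab /andP[_ h]; rewrite c'c; last exact: dom.
      split; last by apply/ballP; rewrite metric_sym -(c'c t (dom _ tab)).
      by exists (c t) => //; apply: cD; exists t => //; exact: dom.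
have {ub}qc := le_trans qc ub; move: qc; rewrite (_ : 2 * de - de = de); last by ring.
move=> qc; rewrite EFinM -muleA.
apply: (@le_trans _ _ (K%:E * ((K^-1)%:E * modulus Q mu (escaping_curves D)))%E).
  by rewrite muleA -EFinM divff ?gt_eqF// mul1e.
by apply: lee_wpmul2l; first by rewrite lee_fin ltW.
Qed.

Hypothesis sepX : separable_space X.

Lemma metric_escaping_modulus (C H c : R) (D : set X) :
  0 <= C -> 0 < c -> 1 <= H ->
  (forall x, exists2 r0 : R, 0 < r0 & forall r : R, 0 < r -> r <= r0 ->
      (mu (ball x r) <= (C * r `^ Q)%:E)%E) ->
  (forall y, exists2 s0 : R, 0 < s0 & forall s : R, 0 < s -> s <= s0 ->
      ((c * s `^ Q)%:E <= nu (ball y s))%E) ->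
  (forall x, V x -> exists2 r0 : R, 0 < r0 &
    forall (r : R) y z, 0 < r -> r < r0 -> V y -> V z -> mdist x y <= r ->
      r <= mdist x z -> mdist (f x) (f y) <= H * mdist (f x) (f z)) ->
  D `<=` V -> open D -> forall eps, 0 < eps ->
  (modulus Q mu (escaping_curves D) <=
     ((2 / 3 * (eps / (de / 2))) `^ Q)%:E * mu D +
     (C * (4 / (de / 2)) `^ Q * ((48 * H) `^ Q / c))%:E *
        nu ((f @` D) `&` ball y1 (2 * de)))%E.
Proof.
move=> C0 c0 H1 massX massY qc DV oD eps eps0.
have de_gt0 := de0.
(* The whole image of [D] might have infinite measure; only the part near [y1] is known to be
   small. *)
pose D' := D `&` [set x | mdist (f x) y1 < 2 * de].
have D'V : D' `<=` V by move=> x [/DV].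
have oD' : open D'.
  apply/open_setP => x [Dx /= fx].
  have [e1 e10 h1] := (open_setP _).1 oD x Dx.
  have fx0 : 0 < 2 * de - mdist (f x) y1 by lra.
  have [e2 e20 h2] := fc (DV _ Dx) fx0.
  exists (Num.min e1 e2); first by rewrite lt_min e10.
  move=> z; rewrite lt_min => /andP[/h1 Dz /h2 fz]; split => //=.
  have := metric_triangle (f z) (f x) y1; rewrite (metric_sym (f z) (f x)); lra.
have fD' : f @` D' = (f @` D) `&` ball y1 (2 * de).
  apply/seteqP; split => [_ [x [Dx /= fx] <-]|_ [[x Dx <-] /ballP fx]].
    by split; [exists x|apply/ballP; rewrite metric_sym].
  by exists x => //; split => //=; rewrite metric_sym.
rewrite -fD'.
have M0 : 0 <= (48 * H) `^ Q / c by rewrite divr_ge0 ?powR_ge0// ltW.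
apply: (@le_trans _ _ (((2 / 3 * (eps / (de / 2))) `^ Q)%:E * mu D' +
     (C * (4 / (de / 2)) `^ Q * ((48 * H) `^ Q / c))%:E * nu (f @` D'))%E); last first.
  rewrite leeD2r//; apply: lee_wpmul2l; first by rewrite lee_fin powR_ge0.
  by apply: le_measure; [apply: mem_set; exact: open_borel_measurable|
    apply: mem_set; exact: open_borel_measurable|move=> x []].
have de20 : 0 < de / 2 by rewrite divr_gt0.
apply: metric_modulus_le => //.
- exact: fopen.
- by move=> x y /D'V Vx /D'V Vy; exact: injf.
- by move=> x /D'V Vx; exact: fc.
- move=> x D'x; have Vx := D'V _ D'x.
  have [r0 r00 massx] := massX x.
  have [s0 s00 massfx] := massY (f x).
  have [r1 r10 qcx] := qc _ Vx.
  have [e1 e10 h1] := (open_setP _).1 oD' x D'x.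
  have ofx : exists2 s1 : R, 0 < s1 & ball (f x) s1 `<=` f @` V.
    have [s1 s10 hs1] := (open_setP _).1 ofV (f x) (ltac:(by exists x)).
    by exists s1 => // y /ballP; exact: hs1.
  (* The four bounds give the requirements of [good_scale]: [r <= 1], [2 * Lam < de / 2], the ball
     of radius [24 * r] in [D'], and the mass bound at radius [6 * r]. *)
  pose eta := Num.min (Num.min 1 (de / 5)) (Num.min (e1 / 24) (r0 / 6)).
  have eta0 : 0 < eta by rewrite !lt_min ltr01 !divr_gt0.
  have [ea eb ec ed] : [/\ eta <= 1, eta <= de / 5, eta <= e1 / 24 & eta <= r0 / 6].
    by rewrite /eta !ge_min !lexx ?orbT.
  have [r [Lam [s [/andP[r_0 reta] /andP[L0 Leta] HL alt]]]] :=
    metric_qc_scale Q0 oV Vx (fc Vx) ofx c0 s00 massfx H1 r10 qcx eps0 eta0.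
  exists (r, Lam, s); split => //.
  + split; first by lra.
    by move=> z /ballP xz; apply: h1; lra.
  + by apply: massx; lra.
  + by split => //; lra.
- move=> ga [gD [a [b [ab domg [p pab hp] [q qab hq]]]]].
  have gc : {within `[a, b], continuous ga}.
    by have := @cmap_continuous _ _ ga; rewrite domg.
  have gDt t : a <= t <= b -> D (ga t).
    by move=> tab; apply: gD; exists t => //; rewrite domg /= in_itv.
  have hcont : {within `[a, b], continuous (fun u => mdist (f (ga u)) y1)}.
    apply: within_continuous_mdist; apply/within_continuous_mdistP => u uab e e0.
    have Vu : V (ga u) by apply/DV/gDt; move: uab; rewrite /= in_itv.
    have [dl dl0 Hdl] := fc Vu e0.
    have [dl' dl'0 Hdl'] := (within_continuous_mdistP _ _).1 gc u uab _ dl0.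
    by exists dl' => // u' u'ab uu'; apply: Hdl; exact: Hdl'.
  (* The subcurve between the levels [de] and [3 / 2 * de] stays in [D'], endpoints included, while
     its image still travels [de / 2]. *)
  have lt1 : de < 3 / 2 * de by lra.
  have hq' : 3 / 2 * de <= mdist (f (ga q)) y1 by lra.
  have [u [v [au uv vb huv Huv]]] := crossing hcont pab qab lt1 hp hq'.
  exists a, b, u, v; split => //; first by split => //; exact: ltW.
    move=> t /andP[ut tv]; split; first by apply: gDt; lra.
    rewrite /=; move: ut; rewrite le_eqVlt => /predU1P[<-|ut].
      by case: huv => -[-> _]; lra.
    move: tv; rewrite le_eqVlt => /predU1P[->|tv]; first by case: huv => -[_ ->]; lra.
    by have := Huv _ ut tv; lra.
  have := mdist_triangle_abs (f (ga u)) (f (ga v)) y1.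
  case: huv => -[-> ->]; last by rewrite ger0_norm; lra.
  by rewrite distrC ger0_norm; lra.
Qed.

End escaping_curves.

Section small_modulus.
Context {R : realType} {d d' : measure_display}.
Context {X : borelMetricType R d} {Y : borelMetricType R d'}.
Variables (Q : R) (mu : {measure set X -> \bar R}) (nu : {measure set Y -> \bar R}).
Variables (V : set X) (f : X -> Y) (x0 : X) (y1 : Y) (de : R).

(** In the metric case the factor of the image measure does not depend on [eps]. The radius is thus
    fixed first, against that term, and [eps] afterwards for each [r], against the finite mass of
    the ball. *)
Lemma escaping_modulus_small (C c R0 : R) :
  0 < Q -> open V -> open (f @` V) ->
  (forall x y, V x -> V y -> f x = f y -> x = y) ->
  (forall x, V x -> forall e : R, 0 < e ->
  exists2 del : R, 0 < del & forall z, mdist x z < del -> mdist (f x) (f z) < e) ->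
  (forall A, A `<=` V -> open A -> open (f @` A)) ->
  0 < de -> separable_space X ->
  0 <= C -> 0 < c ->
  (forall x, exists2 r0 : R, 0 < r0 & forall r : R, 0 < r -> r <= r0 ->
      (mu (ball x r) <= (C * r `^ Q)%:E)%E) ->
  (forall y, exists2 s0 : R, 0 < s0 & forall s : R, 0 < s -> s <= s0 ->
      ((c * s `^ Q)%:E <= nu (ball y s))%E) ->
  metric_quasiconformal V f \/ geometric_quasiconformal Q mu nu V f ->
  0 < R0 -> ball x0 R0 `\ x0 `<=` V -> (nu (ball y1 (2 * de)) < +oo)%E ->
  forall th : R, 0 < th -> exists2 R1 : R, 0 < R1 & forall r : R, 0 < r -> r <= R1 ->
    (modulus Q mu (escaping_curves f y1 de (ball x0 r `\ x0)) <= th%:E)%E.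
Proof.
move=> Q0 oV ofV injf fc fopen de0 sepX C0 c0 massX massY qc R00 BV nufin th th0.
have small := punctured_image_measure_small injf fopen R00 BV nufin.
have DV r : r <= R0 -> ball x0 r `\ x0 `<=` V.
  by move=> rR0; apply: subset_trans BV => x [xB xx0]; split => //; exact: le_ball xB.
case: qc => [/metric_quasiconformal_pointwise[H H1 qc]|[K K1 qc]].
- pose B := C * (4 / (de / 2)) `^ Q * ((48 * H) `^ Q / c).
  have B0 : 0 <= B.
    apply: mulr_ge0; first by rewrite mulr_ge0// powR_ge0.
    by apply: divr_ge0; [exact: powR_ge0|exact: ltW].
  have thB : 0 < th / 2 / (B + 1) by rewrite !divr_gt0// ltr_wpDl.
  have [R1 /andP[R10 R1R0] HR1] := small _ thB.
  have [r0 r00 massx0] := massX x0.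
  exists (Num.min R1 r0); first by rewrite lt_min R10.
  move=> r r_0; rewrite le_min => /andP[rR1 rr0].
  pose m := C * r `^ Q; have m0 : 0 <= m by rewrite mulr_ge0// powR_ge0.
  pose u := (th / 2 / (m + 1)) `^ Q^-1.
  have thm : 0 < th / 2 / (m + 1) by rewrite !divr_gt0// ltr_wpDl.
  have u0 : 0 < u by rewrite powR_gt0.
  pose eps := de / 2 * (3 / 2 * u).
  have eps0 : 0 < eps by rewrite !mulr_gt0// divr_gt0.
  have := @metric_escaping_modulus _ _ _ _ _ Q mu nu V f y1 de Q0 oV ofV injf fc
    fopen de0 sepX C H c _ C0 c0 H1 massX massY qc (DV r (le_trans rR1 R1R0))
    (open_punctured_ball x0 r) eps eps0.
  move=> /le_trans; apply.
  have -> : 2 / 3 * (eps / (de / 2)) = u.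
    by rewrite /eps; field; rewrite gt_eqF.
  rewrite (_ : u `^ Q = th / 2 / (m + 1)); last first.
    by rewrite /u -powRrM mulVf ?gt_eqF// powRr1// ltW.
  rewrite [th in leRHS]splitr EFinD; apply: leeD.
    apply: (@le_trans _ _ ((th / 2 / (m + 1))%:E * m%:E)%E).
      apply: lee_wpmul2l; first by rewrite lee_fin ltW.
      apply: le_trans (massx0 r r_0 rr0).
      apply: le_measure; [| |by move=> x []].
        by apply: mem_set; apply: open_borel_measurable; exact: open_punctured_ball.
      by apply: mem_set; apply: open_borel_measurable; exact: open_ball_metric.
    rewrite -EFinM lee_fin mulrAC ler_pdivrMr; last by rewrite ltr_wpDl.
    by apply: ler_wpM2l; [rewrite divr_ge0// ltW|rewrite lerDl].
  apply: (@le_trans _ _ (B%:E * (th / 2 / (B + 1))%:E)%E).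
    by apply: lee_wpmul2l; rewrite ?lee_fin//; exact: HR1.
  rewrite -EFinM lee_fin mulrA ler_pdivrMr; last by rewrite ltr_wpDl.
  by rewrite mulrC; apply: ler_wpM2l; [rewrite divr_ge0// ltW|rewrite lerDl].
- pose B := K * (de^-1) `^ Q.
  have B0 : 0 < B by rewrite mulr_gt0 ?powR_gt0 ?invr_gt0//; lra.
  have thB : 0 < th / B by rewrite divr_gt0.
  have [R1 /andP[R10 R1R0] HR1] := small _ thB.
  exists R1 => // r r_0 rR1.
  apply: le_trans (geometric_escaping_modulus y1 Q0 fopen de0 K1 (DV r (le_trans rR1 R1R0))
    (open_punctured_ball x0 r) (fun Gamma GV => (qc Gamma GV).1)) _.
  apply: (@le_trans _ _ (B%:E * (th / B)%:E)%E).
    by apply: lee_wpmul2l; [rewrite lee_fin ltW|exact: HR1].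
  by rewrite -EFinM lee_fin mulrC divfK ?gt_eqF.
Qed.

End small_modulus.

(** * Cluster points of the image at the puncture *)

Section removable_puncture.
Context {R : realType} {d d' : measure_display}.
Context {X : borelMetricType R d} {Y : borelMetricType R d'}.
Variables (Q : R) (mu : {measure set X -> \bar R}) (nu : {measure set Y -> \bar R}).
Variables (V : set X) (x0 : X) (f : X -> Y) (g : Y -> X) (r : R).
Hypothesis Q1 : 1 < Q.
Hypothesis oV : open V.
Hypothesis ofV : open (f @` V).
Hypothesis injf : forall x y, V x -> V y -> f x = f y -> x = y.
Hypothesis fc : forall x, V x -> forall e : R, 0 < e ->
  exists2 del : R, 0 < del & forall z, mdist x z < del -> mdist (f x) (f z) < e.
Hypothesis fopen : forall A, A `<=` V -> open A -> open (f @` A).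
Hypothesis gf : forall x, V x -> g (f x) = x.
Hypothesis gc : forall y, (f @` V) y -> forall e : R, 0 < e ->
  exists2 del : R, 0 < del & forall z, mdist y z < del -> mdist (g y) (g z) < e.
Hypothesis Vx0 : ~ V x0.
Hypothesis r0 : 0 < r.
Hypothesis cB : compact (closure (ball x0 r)).
Hypothesis BV : closure (ball x0 r) `\ x0 `<=` V.

Let G := f @` (ball x0 r `\ x0).
Let bB := f @` boundary (ball x0 r).
Let cluster := boundary (f @` (closure (ball x0 r) `\ x0)) `\` bB.

Lemma closure_mdistP (T : metricType R) (A : set T) (y : T) :
  closure A y <-> forall s : R, 0 < s -> exists2 z, A z & mdist y z < s.
Proof.
split=> [clA s s0|H W /nbhs_ballP[s /= s0 yW]].
  by have [z [Az /ballP yz]] := clA _ (nbhsx_ballx y s s0); exists z.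
by have [z Az yz] := H s s0; exists z; split => //; apply/yW/ballP.
Qed.

Lemma boundary_ballE :
  boundary (ball x0 r) = closure (ball x0 r) `&` [set x | r <= mdist x0 x].
Proof.
rewrite /boundary; have /interior_id -> := open_ball_metric x0 r.
apply/seteqP; split => x [clx /= h]; split => //=.
  by rewrite leNgt; apply/negP => h'; apply: h; apply/ballP.
by move=> /ballP; rewrite ltNge h.
Qed.

Lemma closed_bB : closed bB.
Proof.
rewrite /bB boundary_ballE; apply: compact_closed; first exact: metric_hausdorff.
exact: (compact_outer_image cB BV fc r0).
Qed.

(** The closed ball is the open ball together with its boundary, so away from the closed set [bB]
    the images of the closed and of the open punctured balls coincide. *)
Lemma clusterP (y : Y) : cluster y <-> [/\ closure G y, ~ G y & ~ bB y].
Proof.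
have oG : open G by exact: (open_punctured_image BV fopen).
have GS : G `<=` f @` (closure (ball x0 r) `\ x0).
  by move=> _ [x [xB xx0] <-]; exists x => //; split => //; exact: subset_closure.
split=> [[[cly inty] nb]|[cly nG nb]].
- split => //; last by move=> Gy; apply: inty; apply: (interiorS GS); rewrite (interior_id _).1.
  have [s s0 hs] : exists2 s : R, 0 < s & forall z, mdist y z < s -> ~ bB z.
    by have /open_setP := closed_openC closed_bB; apply.
  apply/closure_mdistP => t t0.
  have m0 : 0 < Num.min s t by rewrite lt_min s0.
  have [_ [x [clx xx0] <-]] := (closure_mdistP _ _).1 cly _ m0.
  rewrite lt_min => /andP[ys yt]; exists (f x) => //; exists x => //; split => //.
  apply/ballP; rewrite ltNge; apply/negP => h; apply: (hs _ ys).
  by exists x => //; rewrite boundary_ballE.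
- split => //; split; first exact: closureS cly.
  move=> /interior_subset [x [clx xx0] fx]; have [xr|rx] := ltP (mdist x0 x) r.
    by apply: nG; exists x => //; split => //; apply/ballP.
  by apply: nb; exists x => //; rewrite boundary_ballE.
Qed.

(** A preimage would lie outside the closed ball; the image of that outside is open and misses [G],
    whereas [y] is in the closure of [G]. *)
Lemma cluster_not_image (y : Y) : cluster y -> ~ (f @` V) y.
Proof.
move=> /clusterP[cly nG nb] [x Vx fx].
have xx0 : x <> x0 by move=> xx0; apply: Vx0; rewrite -xx0.
have nclx : ~ closure (ball x0 r) x.
  move=> clx; have [xr|rx] := ltP (mdist x0 x) r.
    by apply: nG; exists x => //; split => //; apply/ballP.
  by apply: nb; exists x => //; rewrite boundary_ballE.
have oW : open (V `&` ~` closure (ball x0 r)).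
  by apply: openI => //; apply: closed_openC; exact: closed_closure.
have oA : open (f @` (V `&` ~` closure (ball x0 r))).
  by apply: fopen => // z [].
have [s s0 hs] := (open_setP _).1 oA y (ltac:(by exists x)).
have [_ [z [zB zx0] <-] yz] := (closure_mdistP _ _).1 cly _ s0.
have [z' [Vz' nz'] fz'] := hs _ yz.
apply: nz'; rewrite (injf Vz' (BV _) fz'); [exact: subset_closure|].
by split => //; exact: subset_closure.
Qed.

Lemma cluster_neighbourhood (y : Y) : cluster y ->
  exists2 s : R, 0 < s & forall z, mdist y z < s -> ~ bB z.
Proof.
move=> /clusterP[_ _ nb].
by have /open_setP := closed_openC closed_bB; apply.
Qed.

Variables (C lam C' lam' : R) (psi psi' : R -> R).
Hypothesis C0 : 0 <= C.
Hypothesis C'0 : 0 <= C'.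
Hypothesis lam01 : 0 < lam <= 1.
Hypothesis lam'01 : 0 < lam' <= 1.
Hypothesis psi0 : forall t, 0 < t -> 0 < psi t.
Hypothesis psi'0 : forall t, 0 < t -> 0 < psi' t.
Hypothesis geomX : forall z, exists2 r0 : R, 0 < r0 & forall r : R, 0 < r -> r <= r0 ->
  (mu (ball z r) <= (C * r `^ Q)%:E)%E /\
  loewner_bound Q mu psi (ball z (lam * r)) (ball z r).
Hypothesis geomY : forall z, exists2 r0 : R, 0 < r0 & forall r : R, 0 < r -> r <= r0 ->
  (nu (ball z r) <= (C' * r `^ Q)%:E)%E /\
  loewner_bound Q nu psi' (ball z (lam' * r)) (ball z r).
Hypothesis sepX : separable_space X.
Hypothesis pathY : pathwise_connected R Y.
Hypothesis qcf : metric_quasiconformal V f \/ geometric_quasiconformal Q mu nu V f.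

Let oG : open G.
Proof. exact: (open_punctured_image BV fopen). Qed.

(** A point of [G] close to [y] is joined to [y] itself, which is not in [G], inside a ball that
    misses [bB]; the part before the first exit from [G] lifts to a path tending to [x0]. *)
Lemma cluster_curve (y p : Y) (rho : R) : cluster y -> p <> y -> 0 < rho ->
  exists (h : R -> X) (a tau : R), [/\ a < tau,
    forall t, a <= t < tau -> h t <> x0 /\ mdist y (f (h t)) < rho,
    forall u, a <= u < tau -> {within `[a, u], continuous h} &
    forall eta : R, 0 < eta -> exists2 u, a <= u < tau & mdist (h u) x0 < eta].
Proof.
move=> Cy py rho0; have [cly nG nb] := (clusterP y).1 Cy.
have [s1 s10 hs1] := cluster_neighbourhood Cy.
have [s2 s20 hs2] := geomY y.
have [r1 r10 hr1] := geomY p.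
have yp : 0 < mdist y p by rewrite mdist_gt0; apply/eqP => yp; apply: py.
pose s := Num.min (Num.min s1 s2) (Num.min rho (mdist y p)).
have s0 : 0 < s by rewrite !lt_min s10 s20 rho0.
have [sa sb sc sd] : [/\ s <= s1, s <= s2, s <= rho & s <= mdist y p].
  by rewrite /s !ge_min !lexx ?orbT.
have /andP[l0 l1] := lam'01.
have ls0 : 0 < lam' * s by rewrite mulr_gt0.
have lss : lam' * s <= s by rewrite ger_pMl.
have [z Gz yz] := (closure_mdistP _ _).1 cly _ ls0.
have pz : p <> z by move=> pz; move: yz; rewrite -pz; lra.
have [_ lb] := hs2 _ s0 sb.
have massp q : 0 < q -> q <= r1 -> (nu (ball p q) <= (C' * q `^ Q)%:E)%E.
  by move=> q0 qr; exact: (hr1 _ q0 qr).1.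
have By : ball y (lam' * s) y by apply/ballP; rewrite mdistxx.
have Bz : ball y (lam' * s) z by apply/ballP.
have [a [b [gam [ab gamc Ga Gb gamB]]]] := join_avoiding Q1 pathY lam'01 s0 psi'0 lb
  C'0 r10 massp oG Bz By Gz nG pz py.
have gambB t : a <= t <= b -> ~ bB (gam t).
  by move=> tab; apply: hs1; have [/ballP h _] := gamB _ tab; lra.
have [tau [/andP[atau taub] inG gcont glim]] :=
  path_to_puncture cB BV fc fopen gf gc ab gamc Ga Gb gambB.
exists (g \o gam), a, tau; split => //.
move=> t /[dup] /inG[_ h1 h2] /andP[at_ tt]; split => //=; rewrite h2.
by have [/ballP h _] := gamB t (ltac:(lra)); lra.
Qed.

(* Two curves tending to [x0] whose images stay near [y1] and near [y2] are
   joined, at each small scale, by a family of curves of modulus at least [psi 4];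
   but [f] maps those that avoid [x0] to curves escaping from [y1], and these have
   small modulus since the images of the punctured balls shrink to nothing. *)
Lemma cluster_subsingleton (y1 y2 : Y) : cluster y1 -> cluster y2 -> y1 = y2.
Proof.
move=> Cy1 Cy2; apply: contrapT => y12.
have Q0 : 0 < Q by have := Q1; lra.
have d0 : 0 < mdist y1 y2 by rewrite mdist_gt0; apply/eqP.
have [s1 s10 hs1] := geomY y1.
(* Points within [de] of [y2] are then at distance at least [2 * de] from [y1], and the ball of
   radius [2 * de] has finite measure. *)
pose de := Num.min (mdist y1 y2 / 4) (s1 / 2).
have de0 : 0 < de by rewrite lt_min !divr_gt0.
have [dea deb] : de <= mdist y1 y2 / 4 /\ de <= s1 / 2.
  by rewrite /de !ge_min !lexx ?orbT.
have nufin : (nu (ball y1 (2 * de)) < +oo)%E.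
  have de20 : 0 < 2 * de by rewrite mulr_gt0.
  have de2s : 2 * de <= s1 by lra.
  by apply: le_lt_trans (hs1 _ de20 de2s).1 _; rewrite ltry.
have [h1 [a1 [tau1 [at1 h1f h1c h1l]]]] := cluster_curve Cy1 (nesym y12) de0.
have [h2 [a2 [tau2 [at2 h2f h2c h2l]]]] := cluster_curve Cy2 y12 de0.
have /andP[l0 l1] := lam01.
have massX x : exists2 r0 : R, 0 < r0 & forall r : R, 0 < r -> r <= r0 ->
      (mu (ball x r) <= (C * r `^ Q)%:E)%E.
  by have [q q0 hq] := geomX x; exists q => // t t0 tq; exact: (hq _ t0 tq).1.
have /andP[l'0 l'1] := lam'01.
pose c := psi' 4 * (lam' / 4) `^ Q.
have c0 : 0 < c by rewrite mulr_gt0 ?psi'0 ?powR_gt0 ?divr_gt0.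
have massY y : exists2 s0 : R, 0 < s0 & forall s : R, 0 < s -> s <= s0 ->
      ((c * s `^ Q)%:E <= nu (ball y s))%E.
  have [q q0 hq] := geomY y.
  (* The mass estimate needs a second point of [Y]; one of [y1] and [y2] differs from [y]. *)
  have [w yw] : exists w, 0 < mdist y w.
    have [y1y|/eqP yy1] := eqVneq y y1; first by exists y2; rewrite y1y.
    by exists y1; rewrite mdist_gt0; apply/eqP.
  exists (Num.min q (mdist y w)); first by rewrite lt_min q0.
  move=> s s0; rewrite le_min => /andP[sq sw].
  have := ball_mass_ge Q0 pathY lam'01 s0 sw (hq _ s0 sq).2.
  rewrite (_ : lam' * s / 4 = lam' / 4 * s); last by ring.
  by rewrite powRM ?mulrA//; [rewrite divr_ge0// ltW|exact: ltW].
have th0 : 0 < psi 4 / 2 by rewrite divr_gt0// psi0.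
have BV' : ball x0 r `\ x0 `<=` V by exact: (punctured_ball_sub BV).
have [R1 R10 HR1] := escaping_modulus_small Q0 oV ofV injf fc fopen de0 sepX C0 c0
  massX massY qcf r0 BV' nufin th0.
have [q q0 hq] := geomX x0.
have h1x0 : 0 < mdist (h1 a1) x0.
  by rewrite mdist_gt0; apply/eqP; apply: (h1f a1 _).1; rewrite lexx.
have h2x0 : 0 < mdist (h2 a2) x0.
  by rewrite mdist_gt0; apply/eqP; apply: (h2f a2 _).1; rewrite lexx.
pose t := Num.min (Num.min (lam / 2 * R1) (lam / 2 * q))
  (Num.min (mdist (h1 a1) x0) (mdist (h2 a2) x0)).
have t0 : 0 < t by rewrite !lt_min h1x0 h2x0 !mulr_gt0// divr_gt0.
have [ta tb tc td] : [/\ t <= lam / 2 * R1, t <= lam / 2 * q,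
    t <= mdist (h1 a1) x0 & t <= mdist (h2 a2) x0].
  by rewrite /t !ge_min !lexx ?orbT.
(* Since [lam * rr = 2 * t], the continua, which lie within [t] of [x0], fit into the smaller ball
   of the Loewner condition. *)
pose rr := 2 / lam * t.
have rr0 : 0 < rr by rewrite !mulr_gt0// invr_gt0.
have lamrr : lam * rr = 2 * t by rewrite /rr; field; rewrite gt_eqF.
have rrle B : t <= lam / 2 * B -> rr <= B.
  move=> h; rewrite -(ler_pM2l l0) lamrr; lra.
have [_ lb] := hq rr rr0 (rrle _ tb).
have [E [cE Eh1 Et [e1 [e2 [Ee1 Ee2 e12]]]]] := tail_continuum t0 tc h1c h1l.
have [F [cF Fh2 Ft [f1 [f2 [Ff1 Ff2 f12]]]]] := tail_continuum t0 td h2c h2l.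
have fE x : E x -> x <> x0 /\ mdist y1 (f x) < de.
  by move=> /Eh1[u + <-]; rewrite /= in_itv/= => /h1f.
have fF x : F x -> x <> x0 /\ mdist y2 (f x) < de.
  by move=> /Fh2[u + <-]; rewrite /= in_itv/= => /h2f.
have fF' x : F x -> 2 * de <= mdist (f x) y1.
  move=> /fF[_ h]; have := metric_triangle y1 (f x) y2.
  rewrite (metric_sym (f x) y2) (metric_sym y1 (f x)); lra.
have t20 : 0 < t / 2 by rewrite divr_gt0.
have low : ((psi 4)%:E <= modulus Q mu (joining_curves E F (ball x0 rr)))%E.
  (* The diameters are at least [t / 2], so the ratio in the Loewner condition is 4. *)
  have ef : mdist e1 f1 <= 2 * t.
    have := metric_triangle e1 x0 f1; rewrite (metric_sym x0 f1).
    by have := Et _ Ee1; have := Ft _ Ff1; lra.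
  apply: (@loewner_bound_points _ _ _ _ _ _ _ _ E F e1 e2 f1 f2 4 lb) => //.
  - rewrite -subset0 => x [/fE[_ h] /fF' h']; rewrite metric_sym in h.
    have : de < de by lra.
    by rewrite ltxx.
  - by move=> x /Et h; apply/ballP; rewrite metric_sym lamrr; lra.
  - by move=> x /Ft h; apply/ballP; rewrite metric_sym lamrr; lra.
  - lra.
  - lra.
  - lra.
  - lra.
have : (modulus Q mu (joining_curves E F (ball x0 rr)) <= (psi 4 / 2)%:E)%E.
  apply: (@le_trans _ _ (modulus Q mu (escaping_curves f y1 de (ball x0 rr `\ x0) `|`
      curves_through x0 (t / 2)))); last first.
    apply: le_trans (modulusU _ _ _ (ltW Q0)) _.
    have massx0 t' : 0 < t' -> t' <= q -> (mu (ball x0 t') <= (C * t' `^ Q)%:E)%E.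
      by move=> t'0 t'q; exact: (hq _ t'0 t'q).1.
    rewrite (modulus_curves_through Q1 C0 q0 t20 massx0) adde0.
    exact: HR1 _ rr0 (rrle _ ta).
  apply: modulus_subset => ga [gB [a [b [ab domg ends]]]].
  have aab : a <= a <= b by rewrite lexx.
  have bab : a <= b <= b by rewrite ab lexx.
  have [[u cu gu]|nthru] := pselect (exists2 u, cdom ga u & ga u = x0).
    right; exists a, b; split => //.
      by exists u => //; move: cu; rewrite domg /= in_itv.
    by case: ends => -[h _]; exists a => //; [have := Et _ h|have := Ft _ h]; lra.
  left; split.
    move=> _ [u cu <-]; split; first by apply: gB; exists u.
    by move=> gu; apply: nthru; exists u.
  exists a, b; split => //.
    case: ends => -[hE hF]; [exists a => //|exists b => //]; rewrite metric_sym ltW//.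
      exact: (fE _ hE).2.
    exact: (fE _ hF).2.
  by case: ends => -[hE hF]; [exists b => //|exists a => //]; exact: fF'.
move=> /(le_trans low); rewrite lee_fin => psi_le.
have psi4 : 0 < psi 4 by exact: psi0.
have : psi 4 < psi 4 by lra.
by rewrite ltxx.
Qed.

Lemma cluster_point_removable (y0 : Y) : cluster y0 ->
  exists U', open_nbhs y0 U' /\ f @` V = U' `\ y0.
Proof.
move=> Cy0; have [cly nG nb] := (clusterP y0).1 Cy0.
have nfV := cluster_not_image Cy0.
exists (f @` V `|` [set y0]); split; last first.
  apply/seteqP; split => [y fy|y [[//|->] /(_ erefl)//]].
  by split; [left|move=> yy0; apply: nfV; rewrite -yy0].
split; last by right.
have [s1 s10 hs1] := cluster_neighbourhood Cy0.
have [s2 s20 hs2] := geomY y0.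
pose s := Num.min s1 s2.
have s0 : 0 < s by rewrite lt_min s10.
have [sa sb] : s <= s1 /\ s <= s2 by rewrite /s !ge_min !lexx ?orbT.
have /andP[l0 l1] := lam'01.
have ls0 : 0 < lam' * s by rewrite mulr_gt0.
have massp q : 0 < q -> q <= s2 -> (nu (ball y0 q) <= (C' * q `^ Q)%:E)%E.
  by move=> q0 qr; exact: (hs2 _ q0 qr).1.
have [z Gz yz] := (closure_mdistP _ _).1 cly _ ls0.
have y0z : y0 <> z by move=> y0z; apply: nG; rewrite y0z.
apply/open_setP => y [fy|->].
  have [e e0 he] := (open_setP _).1 ofV y fy.
  by exists e => // w /he; left.
exists (lam' * s) => // w y0w.
have [->|wy0] := pselect (w = y0); first by right.
left; suff : G w by move=> [x [xB xx0] <-]; exists x => //; apply: (punctured_ball_sub BV).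
apply: contrapT => nGw.
have Bz : ball y0 (lam' * s) z by apply/ballP.
have Bw : ball y0 (lam' * s) w by apply/ballP.
have [a [b [gam [ab gamc Ga Gb gamB]]]] := join_avoiding Q1 pathY lam'01 s0 psi'0
  (hs2 _ s0 sb).2 C'0 s20 massp oG Bz Bw Gz nGw y0z (nesym wy0).
(* The first exit from [G] is in the closure of [G] but neither in [G] nor in [bB]: it is a cluster
   point, so it equals [y0], which the curve avoids. *)
have [tau [atau taub Gtau Gbelow]] := first_exit ab gamc oG Ga Gb.
have tab : a <= tau <= b by rewrite (ltW atau).
have [/ballP gtB gty0] := gamB _ tab.
apply: gty0; apply: cluster_subsingleton => //; apply/clusterP; split => //.
  apply/closure_mdistP => e e0.
  have tI : `[a, b]%classic tau by rewrite /= in_itv/= (ltW atau).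
  have [de de0 hde] := (within_continuous_mdistP _ _).1 gamc tau tI _ e0.
  pose t := Num.max a (tau - de / 2).
  have [tt1 tt2 tt3] : [/\ a <= t, t < tau & tau - t < de].
    rewrite /t; split; first by rewrite le_max lexx.
      by rewrite gt_max atau; lra.
    have : tau - de / 2 <= Num.max a (tau - de / 2) by rewrite le_max lexx orbT.
    lra.
  exists (gam t); first exact: Gbelow.
  apply: hde; first by rewrite /= in_itv/=; lra.
  by rewrite ger0_norm; lra.
by apply: hs1; lra.
Qed.

End removable_puncture.

Theorem theorem1p1 (R : realType) (d d' : measure_display)
  (X : borelMetricType R d) (Y : borelMetricType R d')
  (mu : {measure set X -> \bar R}) (nu : {measure set Y -> \bar R})
  (Q : R) (hQ : 1 < Q)
  (hX : metric_measure_space mu) (hY : metric_measure_space nu)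
  (hXQ : locally_bounded_geometry Q mu) (hYQ : locally_bounded_geometry Q nu)
  (hXpath : pathwise_connected R X) (hYpath : pathwise_connected R Y)
  (hYL : loewner Q nu)
  (x0 : X) (U : set X) (hU : open_nbhs x0 U)
  (f : X -> Y) (hf : quasiconformal Q mu nu (U `\ x0) f)
  (hC : forall r : R, 0 < r ->
    compact (closure (ball x0 r)) -> closure (ball x0 r) `<=` U ->
    continuum (boundary (f @` (closure (ball x0 r) `\ x0)) `\`
               f @` boundary (ball x0 r))) :
  exists (y0 : Y) (U' : set Y),
    open_nbhs y0 U' /\ f @` (U `\ x0) = U' `\ y0.
Proof.
have [oV ofV homf qcf _] := hf.
have [injf fc fopen [g gf gc]] := homeomorphism_on_openP oV ofV homf.
have [C [lam [psi [C1 lam01 psi0 geomX]]]] := bounded_geometry_local hXQ.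
have [C' [lam' [psi' [C'1 lam'01 psi'0 geomY]]]] := bounded_geometry_local hYQ.
have [oU Ux0] := hU.
have [r [r0 cB BU]] : exists r : R, [/\ 0 < r, compact (closure (ball x0 r)) &
    closure (ball x0 r) `<=` U].
  have [_ _ _ [? [? [? [_ _ _ HW]]]]] := hXQ.
  have [W [/nbhs_ballP[r1 /= r10 xW] pW _ _]] := HW x0.
  have [r2 r20 xU] := (open_setP U).1 oU x0 Ux0.
  (* The bound [r1] puts the closed ball into the compact closure of [W]; halving [r2] keeps it in
     [U]. *)
  pose r := Num.min r1 (r2 / 2).
  have r0 : 0 < r by rewrite lt_min r10 divr_gt0.
  have [ra rb] : r <= r1 /\ r <= r2 / 2 by rewrite /r !ge_min !lexx ?orbT.
  exists r; split => //.
    rewrite precompactE in pW; apply: subclosed_compact pW _.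
      exact: closed_closure.
    by apply: closureS; apply: subset_trans xW; exact: le_ball.
  move=> x clx; apply: xU.
  have [z /ballP xz zx] := (closure_mdistP _ _).1 clx _ r0.
  by have := metric_triangle x0 z x; rewrite (metric_sym z x); lra.
have BV : closure (ball x0 r) `\ x0 `<=` U `\ x0 by move=> x [/BU].
have [[y0 Cy0] _ _] := hC r r0 cB BU.
have C0 : 0 <= C by lra.
have C'0 : 0 <= C' by lra.
exists y0.
apply: (@cluster_point_removable _ _ _ _ _ Q mu nu (U `\ x0) x0 f g r hQ oV ofV injf fc
  fopen gf gc _ r0 cB BV C lam C' lam' psi psi') => //.
- by move=> [_ /(_ erefl)].
- by have [] := hX.
Qed.
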